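(* Let $\mathcal{G}=(\mathcal{V},\mathcal{E})$ be a digraph on $n>1$ nodes, and fix activation probabilities $p_{ij}$ and updating weights $w_{ij}$ as in the context. Then $\mathcal{G}$ is strongly connected if and only if there exists $\bar\epsilon>0$ such that for every $\epsilon\in(0,\bar\epsilon)$ the gossip algorithm with parameter $\epsilon$ achieves almost sure average consensus.
   Context: Setting: $\mathcal{V}=\{1,\dots,n\}$, $n>1$, and $\mathcal{G}$ has no selfloops. An edge $(j,i)$ means that $j$ sends to $i$. To each edge $(j,i)\in\mathcal{E}$ are assigned a probability $p_{ij}\in(0,1)$, with $\sum_{(j,i)\in\mathcal{E}}p_{ij}=1$, and an updating weight $w_{ij}\in(0,1)$. Gossip algorithm with parameter $\epsilon>0$: at each time $k\in\mathbb{Z}_+$, exactly one edge is activated. The choice is independent of the past, and edge $(j,i)$ is activated with probability $p_{ij}$. If $(j,i)$ is activated, then $$x_i(k+1)=x_i(k)+w_{ij}(x_j(k)-x_i(k))+\epsilon w_{ij}s_i(k),\qquad s_i(k+1)=s_i(k)+s_j(k)-(x_i(k+1)-x_i(k)),$$ $$x_j(k+1)=x_j(k),\qquad s_j(k+1)=0,$$ and all other nodes keep their state and surplus. The initial condition is $s(0)=0$ with $x(0)\in\mathbb{R}^n$ arbitrary. Almost sure average consensus: for every $x(0)$, $(x(k),s(k))\to(x_a\mathbf{1},0)$ as $k\to\infty$ with probability one, where $x_a=\mathbf{1}^Tx(0)/n$. *)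

(* Defs.v *)
From HB Require Import structures.
From mathcomp Require Import all_boot all_order all_algebra.
From mathcomp Require Import all_classical all_reals all_analysis.
Set Implicit Arguments. Unset Strict Implicit. Unset Printing Implicit Defensive.
Import Order.TTheory GRing.Theory Num.Theory.
Import numFieldNormedType.Exports.
Local Open Scope classical_set_scope.
Local Open Scope ring_scope.

(* Nodes are 'I_n.  The digraph is given by its edge set E : {set 'I_n * 'I_n};
   the pair (j, i) \in E means that j sends to i.  For an edge (j,i) the
   activation probability p_{ij} is [p i j] and the updating weight w_{ij}
   is [w i j]. *)

Section Gossip.
Variables (R : realType) (n : nat).

Definition strongly_connected (E : {set 'I_n * 'I_n}) : Prop :=
  forall u v : 'I_n, connect (fun a b => (a, b) \in E) u v.

Definition gstate := (('I_n -> R) * ('I_n -> R))%type.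

Definition gossip_step (w : 'I_n -> 'I_n -> R) (eps : R)
  (st : gstate) (e : 'I_n * 'I_n) : gstate :=
  let: (x, s) := st in
  let: (j, i) := e in
  let xi' := x i + w i j * (x j - x i) + eps * w i j * s i in
  ( (fun l => if l == i then xi' else x l),
    (fun l => if l == i then s i + s j - (xi' - x i)
              else if l == j then 0 else s l) ).

Fixpoint gossip_state (w : 'I_n -> 'I_n -> R) (eps : R) (x0 : 'I_n -> R)
  (es : nat -> 'I_n * 'I_n) (k : nat) : gstate :=
  match k with
  | 0 => (x0, fun _ => 0)
  | k'.+1 => gossip_step w eps (gossip_state w eps x0 es k') (es k')
  end.

Definition edge_prob (E : {set 'I_n * 'I_n}) (p : 'I_n -> 'I_n -> R)
  (e : 'I_n * 'I_n) : R := if e \in E then p e.2 e.1 else 0.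

(* ev is an i.i.d. sequence of activated edges with law edge_prob E p:
   each ev k is measurable (discrete codomain) and every finite-dimensional
   distribution is the product one. *)
Definition iid_edges d (T : measurableType d) (P : probability T R)
  (ev : nat -> T -> 'I_n * 'I_n) (E : {set 'I_n * 'I_n})
  (p : 'I_n -> 'I_n -> R) : Prop :=
  (forall k a, measurable (ev k @^-1` [set a])) /\
  (forall (k : nat) (a : nat -> 'I_n * 'I_n),
      P [set t | forall m, (m < k)%N -> ev m t = a m]
      = (\prod_(m < k) edge_prob E p (a m))%:E).

Definition as_average_consensus (E : {set 'I_n * 'I_n})
  (p w : 'I_n -> 'I_n -> R) (eps : R) : Prop :=
  forall (d : measure_display) (T : measurableType d) (P : probability T R)
         (ev : nat -> T -> 'I_n * 'I_n),
    iid_edges P ev E p ->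
    forall x0 : 'I_n -> R,
      let xa : R := (\sum_(l < n) x0 l) / n%:R in
      {ae P, forall t, forall l : 'I_n,
         ((fun k => (gossip_state w eps x0 (ev ^~ t) k).1 l) @ \oo --> (xa : R)) /\
         ((fun k => (gossip_state w eps x0 (ev ^~ t) k).2 l) @ \oo --> (0 : R))}.

End Gossip.

(* Main.v *)
Require Import Defs.
From HB Require Import structures.
From mathcomp Require Import all_boot all_order all_algebra.
From mathcomp Require Import all_classical all_reals all_analysis.
From mathcomp Require Import measurable_realfun ring lra.
Set Implicit Arguments. Unset Strict Implicit. Unset Printing Implicit Defensive.
Import Order.TTheory GRing.Theory Num.Theory.
Import numFieldNormedType.Exports.
Local Open Scope ring_scope.

(** Sufficiency.  After subtracting the average, the total of states and
    surpluses is zero, and on that subspace there is a nonnegative function V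
    whose conditional mean decreases at each step by at least
    [c * (|x|^2 + |s|^2)]; hence [\sum_k (|x(k)|^2 + |s(k)|^2)] has finite
    expectation, and the state tends to zero almost surely.  V is
    [\sum_l pi_l (x_l + eps r.s)^2 + eps kappa \sum_(a,b) h_ab |s_a| |s_b|]:
    - [pi] is stationary for the walk jumping from [i] to [j] at rate
      [p_ij w_ij], so for [eps = 0] the first sum loses exactly a Dirichlet form,
      which controls the disagreement of [x];
    - [r] solves a Poisson equation for the walk followed by a unit of surplus, so
      that, to first order in [eps], the pi-mean of [x] is pulled by the total
      surplus, wherever it sits; by conservation the total surplus is about
      [- n] times that mean;
    - [h] is the mean coalescence time of two units of surplus, so the second sum
      loses the off-diagonal products [|s_a| |s_b|], which together with the total
      surplus control [|s|^2].
    All error terms are absorbed when [eps] is small.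

    Necessity.  If [v] cannot be reached from [u], start from the indicator of
    the nodes reachable from [u]: the state at [v] remains zero although the
    average is positive.  This needs an i.i.d. edge sequence to exist; it is read
    off the digits of a uniform real number. *)

(** * Killed chains of random maps *)

Section RandomMaps.
Variables (R : realFieldType) (X I : finType) (p : I -> R) (phi : I -> X -> X).
Variable (Z : {set X}).
Hypothesis p_ge0 : forall i, 0 <= p i.
Hypothesis p_sum1 : \sum_i p i = 1.
Hypothesis reachZ : forall u, exists2 z, z \in Z &
  connect (fun a b => [exists i, (0 < p i) && (phi i a == b)]) u z.

(** At a negative minimum, which lies outside [Z], the mean inequality forces the same value at
    every successor of positive probability. Following such successors leads into [Z], where [f] is
    nonnegative. *)
Lemma killed_min_principle (f : X -> R) :
  (forall u, u \in Z -> 0 <= f u) ->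
  (forall u, u \notin Z -> \sum_i p i * f (phi i u) <= f u) ->
  forall u, 0 <= f u.
Proof.
move=> fZ fsup u0.
case: (@arg_minP _ _ _ u0 xpredT f isT) => u _ umin.
apply: le_trans (umin u0 isT); rewrite leNgt; apply/negP => fu_lt0.
have [z zZ /connectP[s us zE]] := reachZ u.
have const v : f v = f u -> path (fun a b => [exists i, (0 < p i) && (phi i a == b)]) v s ->
    f (last v s) = f u.
  elim: s v {us zE} => //= a s IH v fv /andP[/existsP[i /andP[pi0 /eqP <-]] pas].
  apply: IH pas.
  have vZ : v \notin Z by apply/negP => /fZ; rewrite fv leNgt fu_lt0.
  have t_ge0 j : true -> 0 <= p j * (f (phi j v) - f u).
    by move=> _; rewrite mulr_ge0// subr_ge0 umin.
  have t0 : \sum_j p j * (f (phi j v) - f u) = 0.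
    apply/eqP; rewrite eq_le sumr_ge0 // andbT.
    under eq_bigr do rewrite mulrBr.
    by rewrite sumrB -mulr_suml p_sum1 mul1r -fv subr_le0 fsup.
  have /(_ i isT)/eqP := psumr_eq0P t_ge0 t0.
  by rewrite mulf_eq0 gt_eqF//= subr_eq0 => /eqP.
by have := fZ z zZ; rewrite zE const// leNgt fu_lt0.
Qed.

(** The operator [F], the identity on [Z] and identity minus transition off [Z], is injective by the
    minimum principle applied to both signs of a difference, hence bijective in finite dimension.
    The same principle gives the sign of the solution. *)
Lemma killed_poisson (g : X -> R) : (forall u, 0 <= g u) ->
  exists f : X -> R, [/\ forall u, 0 <= f u, forall u, u \in Z -> f u = 0
    & forall u, u \notin Z -> \sum_i p i * f (phi i u) = f u - g u].
Proof.
move=> g_ge0.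
pose F (f : {ffun X -> R^o}) : {ffun X -> R^o} :=
  [ffun u => if u \in Z then f u else f u - \sum_i p i * f (phi i u)].
have F_lin : linear F.
  move=> a f1 f2; apply/ffunP => u; rewrite !ffunE.
  case: ifP => // _; rewrite scalerBr addrACA -opprD; congr (_ - _).
  rewrite scaler_sumr -big_split /=; apply: eq_bigr => i _.
  by rewrite !ffunE mulrDr; congr (_ + _); rewrite [LHS]mulrCA.
pose Fl : {linear {ffun X -> R^o} -> {ffun X -> R^o}} :=
  HB.pack F (GRing.isLinear.Build _ _ _ _ F F_lin).
have F_min f : (forall u, 0 <= F f u) -> forall u, 0 <= f u.
  move=> Ff; apply: killed_min_principle => u uZ; have := Ff u; rewrite ffunE.
    by rewrite uZ.
  by rewrite (negbTE uZ) subr_ge0.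
have ker0 : lker (linfun Fl) == 0%VS.
  apply/lker0P => f1 f2; rewrite !lfunE /= => E12.
  have F0 : F (f1 - f2) = 0.
    have -> : F (f1 - f2) = Fl (f1 - f2) by [].
    by rewrite linearB /= E12 subrr.
  have F0' : F (f2 - f1) = 0.
    have -> : F (f2 - f1) = Fl (f2 - f1) by [].
    by rewrite linearB /= E12 subrr.
  apply/ffunP => u; apply/eqP; rewrite eq_le.
  have := F_min (f1 - f2) _ u; have := F_min (f2 - f1) _ u.
  rewrite F0 F0' !ffunE !subr_ge0 => le12 le21.
  by apply/andP; split; [apply: le12|apply: le21] => v; rewrite ffunE.
pose g' : {ffun X -> R^o} := [ffun u => if u \in Z then 0 else g u].
pose f := (linfun Fl)^-1%VF g'.
have Ff : F f = g'.
  have -> : F f = linfun Fl f by rewrite lfunE.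
  by rewrite /f lker0_lfunVK.
exists f; split.
- by apply: F_min => u; rewrite Ff ffunE; case: ifP.
- by move=> u uZ; move/ffunP/(_ u): Ff; rewrite !ffunE uZ.
- move=> u uZ; move/ffunP/(_ u): Ff; rewrite !ffunE (negbTE uZ) => <-.
  by rewrite subKr.
Qed.

End RandomMaps.

(** * Irreducible walks on the graph *)

Section Irreducible.
Variables (R : realFieldType) (n : nat) (c : 'I_n * 'I_n -> R).
Hypothesis c_ge0 : forall e, 0 <= c e.
Hypothesis c_conn : forall u v, connect (fun a b => 0 < c (a, b)) u v.

Lemma stationary_exists : (0 < n)%N ->
  exists pi : 'I_n -> R, [/\ forall a, 0 < pi a, \sum_a pi a = 1
    & forall f : 'I_n -> R, \sum_e c e * pi e.2 * (f e.1 - f e.2) = 0].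
Proof.
move=> n_gt0.
(* Generator of the walk jumping from [i] to [a] at rate [c (a, i)]. Its rows sum to zero, so it has
   a left null vector, whose signs are not yet known. *)
pose A := \matrix_(i < n, a < n) (c (a, i) - (i == a)%:R * \sum_j c (j, a)).
have AE (v : 'rV[R]_n) a : (v *m A) 0 a =
    \sum_i c (a, i) * v 0 i - v 0 a * \sum_j c (j, a).
  rewrite mxE; under eq_bigr do rewrite mxE mulrBr.
  rewrite sumrB; congr (_ - _); first by apply: eq_bigr => i _; rewrite mulrC.
  rewrite (bigD1 a) //= eqxx mul1r [X in _ + X]big1 ?addr0 // => i /negbTE ->.
  by rewrite mul0r mulr0.
have /det0P[v v_neq0 vA] : \det A == 0.
  rewrite -det_tr; apply/det0P; exists (const_mx 1).
    apply/eqP => /matrixP/(_ 0 (Ordinal n_gt0)); rewrite !mxE => /eqP.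
    by rewrite oner_eq0.
  apply/matrixP => i0 i; rewrite !mxE.
  under eq_bigr do rewrite !mxE mul1r.
  rewrite sumrB; apply/eqP; rewrite subr_eq0; apply/eqP.
  rewrite [RHS](bigD1 i) //= eqxx mul1r [X in _ = _ + X]big1 ?addr0 // => a.
  by rewrite eq_sym => /negbTE ->; rewrite mul0r.
pose u a := `|v 0 a|.
have u_ge0 a : 0 <= u a by exact: normr_ge0.
have u_le a : u a * \sum_j c (j, a) <= \sum_i c (a, i) * u i.
  have /eqP := AE v a; rewrite vA mxE eq_sym subr_eq0 => /eqP va.
  rewrite /u -[X in _ * X]ger0_norm ?sumr_ge0 // -normrM -va.
  apply: le_trans (ler_norm_sum _ _ _) _; apply: ler_sum => i _.
  by rewrite normrM ger0_norm.
(* The absolute value satisfies stationarity only as an inequality so far; both sides have the same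
   sum over all nodes, so no inequality is strict. *)
have u_stat a : \sum_i c (a, i) * u i = u a * \sum_j c (j, a).
  apply/eqP; rewrite -subr_eq0; apply/eqP.
  have t_ge0 b : true -> 0 <= \sum_i c (b, i) * u i - u b * \sum_j c (j, b).
    by move=> _; rewrite subr_ge0.
  suff t0 : \sum_b (\sum_i c (b, i) * u i - u b * \sum_j c (j, b)) = 0.
    exact: (psumr_eq0P t_ge0 t0).
  rewrite sumrB exchange_big /=; apply/eqP; rewrite subr_eq0; apply/eqP.
  by apply: eq_bigr => i _; rewrite mulr_sumr; apply: eq_bigr => j _; rewrite mulrC.
(* Stationarity passes a zero at [b] to every [d] with [0 < c (b, d)], hence to all nodes,
   contradicting [v != 0]. *)
have u_gt0 a : 0 < u a.
  rewrite lt_neqAle u_ge0 andbT eq_sym; apply/negP => ua0.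
  have step b d : u b == 0 -> 0 < c (b, d) -> u d == 0.
    move=> /eqP ub0 cbd; have := u_stat b; rewrite ub0 mul0r => t0.
    have /(_ d isT)/eqP := psumr_eq0P (fun i _ => mulr_ge0 (c_ge0 _) (u_ge0 i)) t0.
    by rewrite mulf_eq0 gt_eqF.
  case/negP: v_neq0; apply/eqP/rowP => b; rewrite mxE; apply/eqP.
  rewrite -normr_eq0 -[_ == 0]/(u b == 0).
  have /connectP[s + ->] := c_conn a b.
  elim: s a ua0 => //= d s IH a ua0 /andP[cad]; apply: IH; exact: step cad.
have S_gt0 : 0 < \sum_a u a.
  rewrite (bigD1 (Ordinal n_gt0)) //=; apply: ltr_wpDr => //.
  by apply: sumr_ge0.
pose S := \sum_a u a.
have S0 : S != 0 by rewrite gt_eqF.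
exists (fun a => u a / S); split.
- by move=> a; rewrite divr_gt0.
- by rewrite -mulr_suml divff.
- move=> f; have -> : \sum_e c e * (u e.2 / S) * (f e.1 - f e.2) =
      (\sum_e c e * u e.2 * (f e.1 - f e.2)) / S.
    by rewrite mulr_suml; apply: eq_bigr => e _; field.
  suff -> : \sum_e c e * u e.2 * (f e.1 - f e.2) = 0 by rewrite mul0r.
  under eq_bigr do rewrite mulrBr.
  rewrite sumrB.
  have sumE (F : 'I_n * 'I_n -> R) : \sum_e F e = \sum_a \sum_i F (a, i).
    by rewrite pair_bigA /=; apply: eq_bigr => -[].
  rewrite !sumE /=.
  rewrite [X in _ - X]exchange_big /=; apply/eqP; rewrite subr_eq0; apply/eqP.
  apply: eq_bigr => a _; rewrite -mulr_suml u_stat -mulr_suml mulr_sumr.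
  by congr (_ * _); apply: eq_bigr => j _; rewrite mulrC.
Qed.

(** Telescope along a path from [a] to [b]: one edge costs at most the inverse of its weight times
    the Dirichlet form, and each concatenation a factor 2. *)
Lemma poincare : exists2 K : R, 0 < K & forall x : 'I_n -> R,
  \sum_a \sum_b (x a - x b) ^+ 2 <= K * \sum_e c e * (x e.1 - x e.2) ^+ 2.
Proof.
pose D x := \sum_e c e * (x e.1 - x e.2) ^+ 2.
have D_ge0 x : 0 <= D x.
  by apply: sumr_ge0 => e _; rewrite mulr_ge0 // sqr_ge0.
have pairK (ab : 'I_n * 'I_n) : exists K : R, 0 <= K /\
    forall x : 'I_n -> R, (x ab.1 - x ab.2) ^+ 2 <= K * D x.
  case: ab => a b /=; have /connectP[s + ->] := c_conn a b.
  elim: s a => [|d s IH] a /=.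
    by exists 0; split => // x; rewrite subrr mul0r expr0n.
  move=> /andP[cad /IH[K [K_ge0 HK]]].
  exists (2 * (c (a, d))^-1 + 2 * K); split.
    by rewrite addr_ge0 // mulr_ge0 // invr_ge0.
  move=> x; have {}HK := HK x.
  have e1 : (x a - x d) ^+ 2 <= (c (a, d))^-1 * D x.
    rewrite -(ler_pM2l cad) mulVKf ?gt_eqF // /D (bigD1 (a, d)) //=.
    rewrite lerDl; apply: sumr_ge0 => e _; by rewrite mulr_ge0 // sqr_ge0.
  rewrite mulrDl -!mulrA; move: e1 HK.
  move: (_^-1 * D x) (K * D x) (last d s) => A B z e1 HK.
  have : (x a - x z) ^+ 2 <= 2 * (x a - x d) ^+ 2 + 2 * (x d - x z) ^+ 2.
    rewrite -subr_ge0; have -> : 2 * (x a - x d) ^+ 2 + 2 * (x d - x z) ^+ 2 -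
      (x a - x z) ^+ 2 = (x a - x d - (x d - x z)) ^+ 2 by ring.
    exact: sqr_ge0.
  by move: e1 HK; lra.
have /fin_all_exists[K HK] := pairK.
exists (1 + \sum_ab K ab).
  by apply: ltr_pwDl => //; apply: sumr_ge0 => ab _; case: (HK ab).
move=> x; rewrite -/(D x).
apply: (@le_trans _ _ ((\sum_ab K ab) * D x)); last first.
  by rewrite ler_wpM2r // lerDr.
rewrite mulr_suml pair_bigA /=; apply: ler_sum => ab _; exact: (HK ab).2.
Qed.

(** Where a unit of surplus sitting at [a] is found after the activation of [e]. *)
Definition relocate (e : 'I_n * 'I_n) (a : 'I_n) := if a == e.1 then e.2 else a.

Hypothesis c_sum1 : \sum_e c e = 1.

(** Kill the walk at [o] and solve for the sources [q] and 1, giving [u] and [v]. Then [u - qb * v]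
    satisfies the equation off [o] for every [qb], and the equation at [o] fixes [qb]: the mean of
    [q] collected on an excursion from [o], divided by the mean return time. *)
Lemma poisson_exists (q : 'I_n -> R) (o : 'I_n) : (forall a, 0 <= q a) -> 0 < q o ->
  exists (r : 'I_n -> R) (qb : R), 0 < qb /\
    forall a, \sum_e c e * r (relocate e a) = r a + qb - q a.
Proof.
move=> q_ge0 qo.
have reach u : exists2 z, z \in [set o] &
    connect (fun a b => [exists e, (0 < c e) && (relocate e a == b)]) u z.
  exists o; first by rewrite inE.
  apply: connect_sub (c_conn u o) => a b cab; apply: connect1.
  by apply/existsP; exists (a, b); rewrite cab /relocate /= eqxx eqxx.
have [u [u_ge0 uo uE]] := killed_poisson c_ge0 c_sum1 reach q_ge0.
have [v [v_ge0 vo vE]] := killed_poisson c_ge0 c_sum1 reach (fun=> @ler01 R).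
pose Pu := \sum_e c e * u (relocate e o); pose Pv := \sum_e c e * v (relocate e o).
have Pu0 : 0 <= Pu by apply: sumr_ge0 => e _; rewrite mulr_ge0.
have Pv0 : 0 <= Pv by apply: sumr_ge0 => e _; rewrite mulr_ge0.
pose qb := (q o + Pu) / (1 + Pv).
have qbE : qb * (1 + Pv) = q o + Pu by rewrite divfK // gt_eqF // ltr_pwDl.
exists (fun a => u a - qb * v a), qb; split.
  by rewrite divr_gt0 // ltr_pwDl.
move=> a.
have -> : \sum_e c e * (u (relocate e a) - qb * v (relocate e a)) =
    \sum_e c e * u (relocate e a) - qb * \sum_e c e * v (relocate e a).
  by rewrite mulr_sumr -sumrB; apply: eq_bigr => e _; ring.
have [->|ao] := eqVneq a o; last by rewrite uE ?vE ?inE //; ring.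
rewrite uo ?vo ?inE // -/Pu -/Pv; move: qbE; lra.
Qed.

(** Kill the chain of pairs on the diagonal, which is closed because one map moves both units. The
    diagonal is reached by walking the first unit to the second, which stays put until they meet. *)
Lemma coalescence_exists : exists h : 'I_n -> 'I_n -> R,
  [/\ forall a b, 0 <= h a b, forall a, h a a = 0
    & forall a b, \sum_e c e * h (relocate e a) (relocate e b) = h a b - (a != b)%:R].
Proof.
pose phi e (ab : 'I_n * 'I_n) := (relocate e ab.1, relocate e ab.2).
pose Z := [set ab : 'I_n * 'I_n | ab.1 == ab.2].
have reach u : exists2 z, z \in Z &
    connect (fun a b => [exists e, (0 < c e) && (phi e a == b)]) u z.
  case: u => a b; exists (b, b); first by rewrite inE.
  have /connectP[s] := c_conn a b; elim: s a => [|d s IH] a /=.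
    by move=> _ ->; exact: connect0.
  move=> /andP[cad ps bE]; have [->|ab] := eqVneq a b; first exact: connect0.
  apply: connect_trans (IH d ps bE); apply: connect1; apply/existsP.
  by exists (a, d); rewrite cad /phi /relocate /= eqxx [b == a]eq_sym (negbTE ab) eqxx.
have [h [h_ge0 hZ hE]] := killed_poisson c_ge0 c_sum1 reach (fun=> @ler01 R).
exists (fun a b => h (a, b)); split => [a b|a|a b] //.
  by apply: hZ; rewrite inE.
have [<-|ab] := eqVneq a b; last by rewrite (hE (a, b)) ?inE.
rewrite subr0 (hZ (a, a)) ?inE // big1 // => e _.
by rewrite (hZ (_, _)) ?inE ?mulr0.
Qed.

End Irreducible.

(** * One step of the algorithm *)

(** The last estimate of [norm_potx_err], with products such as [d * S] and [eps * S ^+ 2] replaced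
    by variables; only a few products with [B], [K] and [k2] then remain to be supplied. *)
Lemma err_coeff_bound (R : realFieldType) (B K m a2 a3 a4 a5 a6 k2 m' : R) :
  0 <= B -> 0 <= K -> 0 <= k2 -> 0 <= m + m' -> 0 <= a2 -> 0 <= a3 -> 0 <= a4 ->
  a5 <= a2 -> a6 <= a3 ->
  4 * a2 + a4 + 2 * B * (m + m') + 2 * K * (a2 + a3 + a4 + a5)
    + k2 * (a4 + 2 * a5 + a6) <=
  (9 + 2 * B + 4 * K + 2 * k2) * (m + m' + a2 + a3 + a4).
Proof.
move=> B0 K0 k0 h1 h2 h3 h4 h5 h6.
have q1 : K * a5 <= K * a2 by exact: ler_wpM2l.
have q2 : k2 * a5 <= k2 * a2 by exact: ler_wpM2l.
have q3 : k2 * a6 <= k2 * a3 by exact: ler_wpM2l.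
have q4 : 0 <= B * (a2 + a3 + a4) by rewrite mulr_ge0 // !addr_ge0.
have q5 : 0 <= K * (m + m') by rewrite mulr_ge0.
have q6 : 0 <= K * a3 by rewrite mulr_ge0.
have q7 : 0 <= K * a4 by rewrite mulr_ge0.
have q8 : 0 <= k2 * (m + m') by rewrite mulr_ge0.
have q9 : 0 <= k2 * a3 by rewrite mulr_ge0.
have q10 : 0 <= k2 * a4 by rewrite mulr_ge0.
lra.
Qed.

Section OneStep.
Variables (R : rcfType) (n : nat).
Implicit Types (e : 'I_n * 'I_n) (x s f : 'I_n -> R).

Lemma sum_delta (i : 'I_n) f : \sum_l (l == i)%:R * f l = f i.
Proof.
by rewrite (bigD1 i) //= eqxx mul1r big1 ?addr0 // => l /negbTE ->; rewrite mul0r.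
Qed.

Definition push e s : 'I_n -> R := fun l =>
  if l == e.2 then s e.2 + s e.1 else if l == e.1 then 0 else s l.

(** Duality: transporting the surplus along [e] amounts to evaluating the test function at the
    relocated node. *)
Lemma sum_push e s f : e.1 != e.2 ->
  \sum_l f l * push e s l = \sum_a f (relocate e a) * s a.
Proof.
case: e => j i /= ji; rewrite (bigD1 i) //= [RHS](bigD1 i) //=.
rewrite (bigD1 j) //= [X in _ = _ + X](bigD1 j) //= /push /relocate /= !eqxx.
rewrite (negbTE ji) eq_sym (negbTE ji) mulr0 add0r mulrDr -!addrA.
congr (_ + (_ + _)); apply: eq_bigr => l /andP[li lj].
by rewrite (negbTE li) (negbTE lj).
Qed.

Lemma norm_push e s l : `|push e s l| <= push e (fun a => `|s a|) l.
Proof.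
rewrite /push; case: ifP => _; first exact: ler_normD.
by case: ifP => _ //; rewrite normr0.
Qed.

Section Potential.
Variables (pi : 'I_n -> R) (r : 'I_n -> R) (eps : R).
Hypothesis pi_ge0 : forall a, 0 <= pi a.
Hypothesis pi_sum1 : \sum_a pi a = 1.

(* The term in [r] corrects [x] for the drift it is about to receive from the
   surplus at its present location. *)
Definition corr x s l := x l + eps * \sum_a r a * s a.
Definition wmean x s := \sum_l pi l * corr x s l.
Definition potx x s := \sum_l pi l * corr x s l ^+ 2.

Lemma pi_le1 a : pi a <= 1.
Proof. by rewrite -pi_sum1 (bigD1 a) //= lerDl sumr_ge0. Qed.

(** The correction is the same number at every node, so it cancels and a [pi]-average of differences
    of [x] remains. *)
Lemma corr_wmean x s d : (forall a b, `|x a - x b| <= d) ->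
  forall a, `|corr x s a - wmean x s| <= d.
Proof.
move=> xd a; have -> : corr x s a - wmean x s = \sum_l pi l * (x a - x l).
  rewrite -[corr x s a]mul1r -pi_sum1 /wmean mulr_suml -sumrB.
  by apply: eq_bigr => l _; rewrite /corr; ring.
apply: le_trans (ler_norm_sum _ _ _) _.
rewrite -[d]mul1r -pi_sum1 mulr_suml; apply: ler_sum => l _.
by rewrite normrM ger0_norm // ler_wpM2l.
Qed.

Variables (e : 'I_n * 'I_n) (w : R) (x s x' s' : 'I_n -> R).
Hypothesis e_neq : e.1 != e.2.
Let D := w * (x e.1 - x e.2) + eps * w * s e.2.
Hypothesis x'E : forall l, x' l = x l + (l == e.2)%:R * D.
Hypothesis s'E : forall l, s' l = push e s l - (l == e.2)%:R * D.

Lemma sum_s' f : \sum_l f l * s' l = \sum_a f (relocate e a) * s a - f e.2 * D.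
Proof.
under eq_bigr do rewrite s'E mulrBr mulrCA.
by rewrite sumrB sum_push // sum_delta.
Qed.

Let dr := \sum_a (r (relocate e a) - r a) * s a - r e.2 * D.

(** What the expansion of the square leaves beside the leading terms: replacing [corr] by its mean,
    the [eps] parts of [D ^+ 2], and the effect of [D] and of the surplus transfer on the
    correction. *)
Definition potx_err := 2 * eps * pi e.2 * w * (corr x s e.2 - wmean x s) * s e.2
  + 2 * eps * w ^+ 2 * (x e.1 - x e.2) * pi e.2 * s e.2
  + eps ^+ 2 * w ^+ 2 * pi e.2 * s e.2 ^+ 2
  - 2 * eps * wmean x s * r e.2 * D + 2 * eps * pi e.2 * D * dr
  + eps ^+ 2 * dr ^+ 2.

(* In the mean, the second summand vanishes by stationarity of [pi], the third is
   the Dirichlet form, and the fourth reduces to the total surplus. *)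
Lemma potx_step : potx x' s' = potx x s
  + w * pi e.2 * (corr x s e.1 ^+ 2 - corr x s e.2 ^+ 2)
  - pi e.2 * w * (1 - w) * (x e.1 - x e.2) ^+ 2
  + 2 * eps * wmean x s *
    (pi e.2 * w * s e.2 + (\sum_a r (relocate e a) * s a - \sum_a r a * s a))
  + potx_err.
Proof.
have drE : dr = \sum_a r (relocate e a) * s a - \sum_a r a * s a - r e.2 * D.
  by rewrite /dr; congr (_ - _); rewrite -sumrB; apply: eq_bigr => a _; ring.
have corr' l : corr x' s' l = corr x s l + (l == e.2)%:R * D + eps * dr.
  by rewrite /corr sum_s' x'E drE; ring.
have -> : potx x' s' = potx x s + 2 * (eps * dr) * wmean x s + (eps * dr) ^+ 2
   + pi e.2 * (2 * corr x s e.2 * D + D ^+ 2 + 2 * (eps * dr) * D).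
  rewrite -[X in _ + X](sum_delta e.2 (fun l => pi l *
    (2 * corr x s l * D + D ^+ 2 + 2 * (eps * dr) * D))).
  rewrite -[(eps * dr) ^+ 2]mul1r -[X in X * _ ^+ 2]pi_sum1 mulr_suml.
  rewrite /wmean mulr_sumr /potx -!big_split /=; apply: eq_bigr => l _.
  by rewrite corr'; case: (l == e.2) => /=; ring.
rewrite /potx_err !drE /D /corr; ring.
Qed.

Variables (d S B : R).
Hypothesis eps01 : 0 <= eps <= 1.
Hypothesis w01 : 0 <= w <= 1.
Hypothesis d_ge0 : 0 <= d.
Hypothesis S_ge0 : 0 <= S.
Hypothesis B_ge1 : 1 <= B.
Hypothesis xd : forall a b, `|x a - x b| <= d.
Hypothesis sS : forall a, `|s a| <= S.
Hypothesis rB : forall a, `|r a| <= B.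

(** After multiplication by a small [eps], each of these products is dominated by [d ^+ 2],
    [eps * M ^+ 2] and [eps * S ^+ 2]; this is the form that [small_gain] absorbs. *)
Definition errphi (M : R) := M * d + eps * M * S + d * S + d ^+ 2 + eps * S ^+ 2.

Lemma norm_D : `|D| <= d + eps * S.
Proof.
case/andP: eps01 => e0 e1; case/andP: w01 => w0 w1.
apply: le_trans (ler_normD _ _) _; apply: lerD.
  rewrite normrM ger0_norm // -[d]mul1r; exact: ler_pM.
rewrite !normrM (ger0_norm e0) (ger0_norm w0) -mulrA ler_wpM2l // -[S]mul1r; exact: ler_pM.
Qed.

Lemma norm_dr : `|dr| <= (2 * n%:R + 1) * B * (S + d).
Proof.
case/andP: eps01 => e0 e1.
have B0 : 0 <= B by exact: le_trans ler01 B_ge1.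
apply: le_trans (ler_normB _ _) _.
have h1 : `|\sum_a (r (relocate e a) - r a) * s a| <= n%:R * (2 * B * S).
  apply: le_trans (ler_norm_sum _ _ _) _.
  have -> : n%:R * (2 * B * S) = \sum_(a < n) (2 * B * S).
    by rewrite sumr_const card_ord mulr_natl.
  apply: ler_sum => a _; rewrite normrM; apply: ler_pM => //.
  by apply: le_trans (ler_normB _ _) _; have := rB (relocate e a); have := rB a; lra.
have h2 : `|r e.2 * D| <= B * (d + eps * S).
  by rewrite normrM; apply: ler_pM => //; exact: norm_D.
apply: le_trans (lerD h1 h2) _.
have h3 : B * (eps * S) <= B * S by rewrite ler_wpM2l // -[leRHS]mul1r ler_wpM2r.
have h4 : 0 <= n%:R * B * d by rewrite !mulr_ge0.
move: (n%:R) h3 h4 => N; nra.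
Qed.

Lemma norm_potx_err : `|potx_err| <=
  (9 + 2 * B + 4 * ((2 * n%:R + 1) * B) + 2 * ((2 * n%:R + 1) * B) ^+ 2) *
  eps * errphi `|wmean x s|.
Proof.
case/andP: eps01 => e0 e1; case/andP: w01 => w0 w1.
have Dle := norm_D; have drle := norm_dr.
have Xm := corr_wmean s xd e.2.
have pi0 := pi_ge0 e.2; have pi1 := pi_le1 e.2.
have N0 : 0 <= n%:R :> R by [].
rewrite /potx_err /errphi.
set M := `|wmean x s|.
have leM : `|wmean x s| <= M by [].
have M0 : 0 <= M by exact: normr_ge0.
set K := (2 * n%:R + 1) * B in drle *.
have K0 : 0 <= K by rewrite mulr_ge0 // ?addr_ge0 ?mulr_ge0 //; move: B_ge1; lra.
have sq a b : `|a| <= b -> `|a ^+ 2| <= b ^+ 2 :> R.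
  by move=> ab; rewrite normrX ler_sqr ?nnegrE // (le_trans _ ab).
have ml (a b a' b' : R) : `|a| <= a' -> `|b| <= b' -> `|a * b| <= a' * b'.
  by move=> *; rewrite normrM ler_pM.
have two : `|2| <= 2 :> R by rewrite ger0_norm.
have eps0 : `|eps| <= eps by rewrite ger0_norm.
have pi1' : `|pi e.2| <= 1 by rewrite ger0_norm.
have w1' : `|w| <= 1 by rewrite ger0_norm.
have wsq := sq _ _ w1'.
have esq := sq _ _ eps0.
have ssq := sq _ _ (sS e.2).
(* The six summands of [potx_err] are bounded in order, factor by factor. *)
have b1 : `|2 * eps * pi e.2 * w * (corr x s e.2 - wmean x s) * s e.2|
    <= 2 * eps * 1 * 1 * d * S.
  by do !(done || apply: (ml _ _ _ _)).
have b2 : `|2 * eps * w ^+ 2 * (x e.1 - x e.2) * pi e.2 * s e.2|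
    <= 2 * eps * 1 ^+ 2 * d * 1 * S.
  by do !(done || apply: (ml _ _ _ _)).
have b3 : `|eps ^+ 2 * w ^+ 2 * pi e.2 * s e.2 ^+ 2| <= eps ^+ 2 * 1 ^+ 2 * 1 * S ^+ 2.
  by do !(done || apply: (ml _ _ _ _)).
have b4 : `|2 * eps * wmean x s * r e.2 * D| <= 2 * eps * M * B * (d + eps * S).
  by do !(done || apply: (ml _ _ _ _)).
have b5 : `|2 * eps * pi e.2 * D * dr| <= 2 * eps * 1 * (d + eps * S) * (K * (S + d)).
  by do !(done || apply: (ml _ _ _ _)).
have b6 : `|eps ^+ 2 * dr ^+ 2| <= eps ^+ 2 * (K * (S + d)) ^+ 2.
  by apply: (ml _ _ _ _); apply: (sq _ _).
apply: (@le_trans _ _ (2 * eps * 1 * 1 * d * S + 2 * eps * 1 ^+ 2 * d * 1 * S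
   + eps ^+ 2 * 1 ^+ 2 * 1 * S ^+ 2 + 2 * eps * M * B * (d + eps * S)
   + 2 * eps * 1 * (d + eps * S) * (K * (S + d)) + eps ^+ 2 * (K * (S + d)) ^+ 2)).
  do 3! (apply: le_trans (ler_normD _ _) _; apply: lerD => //).
  all: try by rewrite normrN.
  do 2! (apply: le_trans (ler_normD _ _) _; apply: lerD => //).
have -> : 2 * eps * 1 * 1 * d * S + 2 * eps * 1 ^+ 2 * d * 1 * S
   + eps ^+ 2 * 1 ^+ 2 * 1 * S ^+ 2 + 2 * eps * M * B * (d + eps * S)
   + 2 * eps * 1 * (d + eps * S) * (K * (S + d)) + eps ^+ 2 * (K * (S + d)) ^+ 2 =
   eps * (4 * (d * S) + eps * S ^+ 2 + 2 * B * (M * d + eps * M * S)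
    + 2 * K * (d * S + d ^+ 2 + eps * S ^+ 2 + eps * (d * S))
    + K ^+ 2 * (eps * S ^+ 2 + 2 * (eps * (d * S)) + eps * d ^+ 2)) by ring.
rewrite [leRHS](_ : _ = eps * ((9 + 2 * B + 4 * K + 2 * K ^+ 2) *
  (M * d + eps * M * S + d * S + d ^+ 2 + eps * S ^+ 2))); last by ring.
apply: ler_wpM2l => //.
have dS0 : 0 <= d * S by rewrite mulr_ge0.
have dd0 : 0 <= d ^+ 2 by rewrite sqr_ge0.
have SS0 : 0 <= eps * S ^+ 2 by rewrite mulr_ge0 ?sqr_ge0.
have Md0 : 0 <= M * d + eps * M * S by rewrite addr_ge0 ?mulr_ge0.
have edS : eps * (d * S) <= d * S by rewrite -[leRHS]mul1r ler_wpM2r.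
have edd : eps * d ^+ 2 <= d ^+ 2 by rewrite -[leRHS]mul1r ler_wpM2r.
have KK0 : 0 <= K ^+ 2 by exact: sqr_ge0.
by apply: (@err_coeff_bound R) => //; exact: le_trans ler01 B_ge1.
Qed.

End Potential.
End OneStep.

(** * The pair potential of the surpluses *)

Section PairPotential.
Variables (R : rcfType) (n : nat) (h : 'I_n -> 'I_n -> R).
Hypothesis h_ge0 : forall a b, 0 <= h a b.
Hypothesis h_diag : forall a, h a a = 0.

(* With absolute values the potential is nonnegative, and merging two surpluses
   can only decrease it. *)
Definition pots (s : 'I_n -> R) := \sum_a \sum_b h a b * (`|s a| * `|s b|).

Lemma pots_ge0 s : 0 <= pots s.
Proof. by apply: sumr_ge0 => a _; apply: sumr_ge0 => b _; rewrite !mulr_ge0. Qed.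

(** [|s'|] is dominated by [T], the pushed absolute values plus [|D|] at the receiver. In the
    quadratic form of [T] the term in [|D| ^+ 2] sits on the diagonal, where [h] vanishes, so the
    error is linear in [|D|]. *)
Lemma pots_step (e : 'I_n * 'I_n) (s s' : 'I_n -> R) (D S H : R) :
  e.1 != e.2 -> (forall l, s' l = push e s l - (l == e.2)%:R * D) ->
  (forall a b, h a b <= H) -> (forall a, `|s a| <= S) ->
  pots s' <= \sum_a \sum_b h (relocate e a) (relocate e b) * (`|s a| * `|s b|)
             + 2 * n%:R * H * `|D| * S.
Proof.
move=> e_neq s'E hH sS.
pose T l := push e (fun a => `|s a|) l + (l == e.2)%:R * `|D|.
have T_ge l : `|s' l| <= T l.
  rewrite s'E; apply: le_trans (ler_normB _ _) _; apply: lerD; first exact: norm_push.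
  by rewrite normrM ger0_norm.
have sumT (f : 'I_n -> R) :
    \sum_l f l * T l = \sum_a f (relocate e a) * `|s a| + f e.2 * `|D|.
  under eq_bigr do rewrite /T mulrDr mulrCA.
  by rewrite big_split /= sum_push // sum_delta.
have -> : 2 * n%:R * H * `|D| * S = \sum_(a < n) H * `|D| * S + \sum_(a < n) H * S * `|D|.
  rewrite !sumr_const card_ord -(mulr_natl (H * `|D| * S)) -(mulr_natl (H * S * `|D|)).
  ring.
apply: (@le_trans _ _ (\sum_l \sum_m h l m * (T l * T m))).
  apply: ler_sum => l _; apply: ler_sum => m _.
  by rewrite ler_wpM2l // ler_pM.
have -> : \sum_l \sum_m h l m * (T l * T m) =
    \sum_l (\sum_b h l (relocate e b) * `|s b| + h l e.2 * `|D|) * T l.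
  apply: eq_bigr => l _; rewrite -sumT mulr_suml; apply: eq_bigr => m _; ring.
rewrite (sumT (fun l => \sum_b h l (relocate e b) * `|s b| + h l e.2 * `|D|)).
under eq_bigr do rewrite mulrDl.
rewrite big_split /= h_diag mul0r addr0 -!addrA; apply: lerD; last apply: lerD.
- apply: ler_sum => a _; rewrite mulr_suml; apply: ler_sum => b _.
  by rewrite -mulrA [`|s b| * _]mulrC.
- apply: ler_sum => a _; apply: ler_pM => //; first by rewrite mulr_ge0.
  by rewrite ler_wpM2r.
- rewrite mulr_suml; apply: ler_sum => b _; rewrite ler_wpM2r //.
  by rewrite ler_pM.
Qed.

(** Turns the loss of off-diagonal products into a loss of the squares, at the price of the squared
    total surplus. *)
Lemma offdiag_sum (s : 'I_n -> R) :
  \sum_a s a ^+ 2 - (\sum_a s a) ^+ 2 <=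
  \sum_a \sum_b (a != b)%:R * (`|s a| * `|s b|).
Proof.
have -> : (\sum_a s a) ^+ 2 = \sum_a \sum_b s a * s b.
  by rewrite expr2 mulr_suml; apply: eq_bigr => a _; rewrite mulr_sumr.
rewrite -sumrB; apply: ler_sum => a _.
have -> : s a ^+ 2 = \sum_b (b == a)%:R * (s a * s b).
  by rewrite (sum_delta a (fun b => s a * s b)) expr2.
rewrite -sumrB; apply: ler_sum => b _.
have [->|ab] := eqVneq b a; first by rewrite mul1r mul0r subrr.
by rewrite mul1r mul0r sub0r -normrM -normrN ler_norm.
Qed.

End PairPotential.

(** * Absorbing the error terms *)

Lemma small_gain (R : realFieldType) (g C : R) : 0 < g -> 0 <= C ->
  exists2 epsb : R, 0 < epsb <= 1 & forall eps : R, 0 < eps < epsb ->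
  forall M d S : R, 0 <= M -> 0 <= d -> 0 <= S ->
  - g * (d ^+ 2 + eps * M ^+ 2 + eps * S ^+ 2) +
    C * eps * (M * d + eps * M * S + d * S + d ^+ 2 + eps * S ^+ 2) <=
  - (eps * g / 2) * (M ^+ 2 + d ^+ 2 + S ^+ 2).
Proof.
move=> g0 C0.
(* Chosen so that [eps * den < g ^+ 2] yields at once [eps <= 1], [c1] and [c2]. *)
pose den := g ^+ 2 + 10 * C * g + 4 * C ^+ 2.
have g20 : 0 < g ^+ 2 by rewrite exprn_gt0.
have Cg : 0 <= C * g by rewrite mulr_ge0 // ltW.
have CC : 0 <= C ^+ 2 by rewrite sqr_ge0.
have den0 : 0 < den by rewrite /den; lra.
exists (g ^+ 2 / den).
  by rewrite divr_gt0 //= ler_pdivrMr // mul1r /den; lra.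
move=> eps /andP[e0]; rewrite ltr_pdivlMr // => eden M d S M0 d0 S0.
have e1 : eps <= 1.
  rewrite -(ler_pM2r den0) mul1r; apply: le_trans (ltW eden) _; rewrite /den; lra.
have c1 : 8 * C * eps <= g.
  rewrite -(ler_pM2r g0) -expr2; apply: le_trans (ltW eden); rewrite /den.
  have := mulr_ge0 (ltW e0) Cg; have := mulr_ge0 (ltW e0) CC.
  have := mulr_ge0 (ltW e0) (ltW g20); lra.
have c2 : eps * (4 * C ^+ 2 + 2 * C * g) <= g ^+ 2.
  apply: le_trans (ltW eden); rewrite ler_wpM2l ?(ltW e0) // /den; lra.
(* Young's inequality, weighted to spend a quarter of the margin on [u ^+ 2]. The goal is multiplied
   by [g] below so that no division occurs. *)
have y1 (u : R) : C * (u * d) * g <= g ^+ 2 / 4 * u ^+ 2 + C ^+ 2 * d ^+ 2.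
  have := sqr_ge0 (g / 2 * u - C * d); lra.
have y2 : 2 * (M * S) <= M ^+ 2 + S ^+ 2 by have := sqr_ge0 (M - S); lra.
rewrite -(ler_pM2r g0).
have dd : 0 <= d ^+ 2 by rewrite sqr_ge0.
have MM : 0 <= M ^+ 2 by rewrite sqr_ge0.
have SS : 0 <= S ^+ 2 by rewrite sqr_ge0.
have z1 := ler_wpM2l (ltW e0) (y1 M).
have z2 := ler_wpM2l (ltW e0) (y1 S).
have z3 : eps * (4 * C ^+ 2 + 2 * C * g) * d ^+ 2 <= g ^+ 2 * d ^+ 2.
  by rewrite ler_wpM2r.
have z4 : eps * g * (8 * C * eps) * (M ^+ 2 + S ^+ 2) <= eps * g * g * (M ^+ 2 + S ^+ 2).
  by rewrite ler_wpM2r ?addr_ge0 // ler_wpM2l // mulr_ge0 // ltW.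
have z5 : C * g * eps ^+ 2 * (2 * (M * S)) <= C * g * eps ^+ 2 * (M ^+ 2 + S ^+ 2).
  by rewrite ler_wpM2l // mulr_ge0 // sqr_ge0.
have z6 : eps * (g ^+ 2 * d ^+ 2) <= 1 * (g ^+ 2 * d ^+ 2).
  by rewrite ler_wpM2r // mulr_ge0 // ltW.
have z7 : 0 <= C * g * eps ^+ 2 * M ^+ 2 by rewrite !mulr_ge0 // ?sqr_ge0 // ltW.
have z8 : 0 <= C * g * eps ^+ 2 * S ^+ 2 by rewrite !mulr_ge0 // ?sqr_ge0 // ltW.
lra.
Qed.

(** * Mean decrease of the Lyapunov function *)

Section Drift.
Variables (R : rcfType) (n : nat) (p w : 'I_n * 'I_n -> R).
Variables (pi r : 'I_n -> R) (qb : R) (h : 'I_n -> 'I_n -> R).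
Hypothesis p_ge0 : forall e, 0 <= p e.
Hypothesis p_sum1 : \sum_e p e = 1.
Hypothesis p_neq : forall e, 0 < p e -> e.1 != e.2.
Hypothesis w01 : forall e, 0 < p e -> 0 <= w e <= 1.
Hypothesis pi_ge0 : forall a, 0 <= pi a.
Hypothesis pi_sum1 : \sum_a pi a = 1.
Hypothesis pi_stat : forall f : 'I_n -> R,
  \sum_e p e * w e * pi e.2 * (f e.1 - f e.2) = 0.
Hypothesis r_poisson : forall a, \sum_e p e * r (relocate e a) =
  r a + qb - \sum_e p e * ((a == e.2)%:R * (w e * pi a)).
Hypothesis h_ge0 : forall a b, 0 <= h a b.
Hypothesis h_diag : forall a, h a a = 0.
Hypothesis h_coal : forall a b,
  \sum_e p e * h (relocate e a) (relocate e b) = h a b - (a != b)%:R.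

Lemma le_mean (F G : 'I_n * 'I_n -> R) : (forall e, 0 < p e -> F e <= G e) ->
  \sum_e p e * F e <= \sum_e p e * G e.
Proof.
move=> FG; apply: ler_sum => e _.
have [p0|] := ltP 0 (p e); first by rewrite ler_wpM2l // FG.
by move=> pe0; have -> : p e = 0 by [apply/eqP; rewrite eq_le pe0 p_ge0]; rewrite !mul0r.
Qed.

Lemma mean_const (C : R) : \sum_e p e * C = C.
Proof. by rewrite -mulr_suml p_sum1 mul1r. Qed.

Definition dirichlet (x : 'I_n -> R) :=
  \sum_e p e * (pi e.2 * w e * (1 - w e) * (x e.1 - x e.2) ^+ 2).

Variables (eps d S B H : R) (x s : 'I_n -> R) (x' s' : 'I_n * 'I_n -> 'I_n -> R).
Let D e := w e * (x e.1 - x e.2) + eps * w e * s e.2.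
Hypothesis x'E : forall e l, 0 < p e -> x' e l = x l + (l == e.2)%:R * D e.
Hypothesis s'E : forall e l, 0 < p e -> s' e l = push e s l - (l == e.2)%:R * D e.
Hypothesis eps01 : 0 <= eps <= 1.
Hypothesis d_ge0 : 0 <= d.
Hypothesis S_ge0 : 0 <= S.
Hypothesis B_ge1 : 1 <= B.
Hypothesis H_ge0 : 0 <= H.
Hypothesis xd : forall a b, `|x a - x b| <= d.
Hypothesis sS : forall a, `|s a| <= S.
Hypothesis rB : forall a, `|r a| <= B.
Hypothesis hH : forall a b, h a b <= H.

Let M := wmean pi r eps x s.
Let Phi := errphi eps d S `|M|.
Let C1 := 9 + 2 * B + 4 * ((2 * n%:R + 1) * B) + 2 * ((2 * n%:R + 1) * B) ^+ 2.

Lemma mean_potx : \sum_e p e * potx pi r eps (x' e) (s' e) <=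
  potx pi r eps x s - dirichlet x + 2 * eps * M * (qb * \sum_a s a) + C1 * eps * Phi.
Proof.
pose f l := corr r eps x s l ^+ 2.
pose G e := potx pi r eps x s + w e * pi e.2 * (f e.1 - f e.2)
  - pi e.2 * w e * (1 - w e) * (x e.1 - x e.2) ^+ 2
  + 2 * eps * M *
    (pi e.2 * w e * s e.2 + (\sum_a r (relocate e a) * s a - \sum_a r a * s a))
  + C1 * eps * Phi.
apply: (@le_trans _ _ (\sum_e p e * G e)).
  apply: le_mean => e pe.
  rewrite (@potx_step _ _ pi r eps pi_sum1 e (w e) x s (x' e) (s' e)) //; last first.
  - by move=> l; exact: s'E.
  - by move=> l; exact: x'E.
  - exact: p_neq.
  rewrite /G lerD2l.
  have := @norm_potx_err _ _ pi r eps pi_ge0 pi_sum1 e (w e) x s d S B eps01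
     (w01 pe) d_ge0 S_ge0 B_ge1 xd sS rB.
  by apply: le_trans; exact: ler_norm.
have mean_push : \sum_e p e * \sum_a r (relocate e a) * s a =
    \sum_a (r a + qb - \sum_e p e * ((a == e.2)%:R * (w e * pi a))) * s a.
  under eq_bigr do rewrite mulr_sumr.
  rewrite exchange_big /=; apply: eq_bigr => a _; rewrite -r_poisson mulr_suml.
  by apply: eq_bigr => e _; ring.
have qE : \sum_e p e * (pi e.2 * w e * s e.2) =
    \sum_a (\sum_e p e * ((a == e.2)%:R * (w e * pi a))) * s a.
  under [RHS]eq_bigr do rewrite mulr_suml.
  rewrite exchange_big /=; apply: eq_bigr => e _.
  rewrite -(sum_delta e.2 (fun a => pi a * w e * s a)) mulr_sumr.
  by apply: eq_bigr => a _; ring.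
(* The pull exerted by a unit of surplus depends on its node; the mean change of [r] compensates
   this by the Poisson equation and leaves the constant [qb]. *)
have main : \sum_e p e * (pi e.2 * w e * s e.2)
    + \sum_e p e * \sum_a r (relocate e a) * s a - \sum_a r a * s a = qb * \sum_a s a.
  rewrite mean_push qE mulr_sumr -big_split /= -sumrB.
  by apply: eq_bigr => a _; ring.
rewrite -main.
have -> : \sum_e p e * G e = \sum_e p e * (potx pi r eps x s)
   + \sum_e p e * w e * pi e.2 * (f e.1 - f e.2) - dirichlet x
   + 2 * eps * M * (\sum_e p e * (pi e.2 * w e * s e.2)
    + \sum_e p e * (\sum_a r (relocate e a) * s a) - \sum_e p e * (\sum_a r a * s a))
   + \sum_e p e * (C1 * eps * Phi).
  rewrite /dirichlet -!big_split /= -!sumrB mulr_sumr -!big_split /=.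
  by apply: eq_bigr => e _; rewrite /G; ring.
by rewrite !mean_const pi_stat addr0.
Qed.

(** The coalescence equation yields the loss of the off-diagonal products, which [offdiag_sum]
    converts; the error is controlled by [(d + eps * S) * S], part of [Phi]. *)
Lemma mean_pots : \sum_e p e * pots h (s' e) <=
  pots h s - \sum_a s a ^+ 2 + (\sum_a s a) ^+ 2 + 2 * n%:R * H * Phi.
Proof.
have DS e : 0 < p e -> `|D e| * S <= Phi.
  move=> pe; have Dle := @norm_D _ _ eps e (w e) x s d S eps01 (w01 pe) xd sS.
  apply: le_trans (ler_wpM2r S_ge0 Dle) _; rewrite /Phi /errphi.
  have [e0 e1] := andP eps01.
  have h1 : 0 <= `|M| * d by rewrite mulr_ge0.
  have h2 : 0 <= eps * `|M| * S by rewrite !mulr_ge0.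
  have h3 : 0 <= d ^+ 2 by rewrite sqr_ge0.
  lra.
apply: (@le_trans _ _ (\sum_e p e *
  (\sum_a \sum_b h (relocate e a) (relocate e b) * (`|s a| * `|s b|) + 2 * n%:R * H * Phi))).
  apply: le_mean => e pe.
  apply: le_trans (@pots_step _ _ h h_ge0 h_diag e s (s' e) (D e) S H _ _ hH sS) _.
  - exact: p_neq.
  - by move=> l; exact: s'E.
  by rewrite lerD2l -mulrA ler_wpM2l ?mulr_ge0 // DS.
under eq_bigr do rewrite mulrDr.
rewrite big_split /= mean_const lerD2r.
have -> : \sum_e p e * (\sum_a \sum_b h (relocate e a) (relocate e b) * (`|s a| * `|s b|)) =
    pots h s - \sum_a \sum_b (a != b)%:R * (`|s a| * `|s b|).
  under eq_bigr do rewrite mulr_sumr.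
  rewrite exchange_big /= /pots -sumrB; apply: eq_bigr => a _.
  under eq_bigr do rewrite mulr_sumr.
  rewrite exchange_big /= -sumrB; apply: eq_bigr => b _.
  rewrite -mulrBl -h_coal mulr_suml; apply: eq_bigr => e _; ring.
have := offdiag_sum s; lra.
Qed.

Hypothesis sum0 : \sum_a x a + \sum_a s a = 0.

(** By conservation the total surplus is minus the sum of [x], and each [x a] differs from [M] by at
    most [d] plus the correction, which has order [eps * S]. *)
Lemma surplus_mean : `|\sum_a s a + n%:R * M| <= n%:R ^+ 2 * B * (d + eps * S).
Proof.
have [e0 e1] := andP eps01; have B0 := le_trans ler01 B_ge1.
have -> : \sum_a s a + n%:R * M =
    \sum_a (M - corr r eps x s a) + n%:R * (eps * \sum_a r a * s a).
  have cst (c : R) : n%:R * c = \sum_(a < n) c by rewrite sumr_const card_ord mulr_natl.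
  have E : \sum_a (M - corr r eps x s a) =
      n%:R * M - \sum_a x a - n%:R * (eps * \sum_a r a * s a).
    by rewrite sumrB /corr big_split /= -!cst opprD addrA.
  have -> : \sum_a s a = - \sum_a x a by apply/eqP; rewrite -addr_eq0 addrC sum0.
  by rewrite E subrK addrC.
have h1 : `|\sum_a (M - corr r eps x s a)| <= n%:R * d.
  apply: le_trans (ler_norm_sum _ _ _) _.
  have -> : n%:R * d = \sum_(a < n) d by rewrite sumr_const card_ord mulr_natl.
  by apply: ler_sum => a _; rewrite distrC corr_wmean.
have h2 : `|\sum_a r a * s a| <= n%:R * (B * S).
  apply: le_trans (ler_norm_sum _ _ _) _.
  have -> : n%:R * (B * S) = \sum_(a < n) (B * S) by rewrite sumr_const card_ord mulr_natl.
  by apply: ler_sum => a _; rewrite normrM ler_pM.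
apply: le_trans (ler_normD _ _) _.
rewrite !normrM (ger0_norm e0) normr_nat mulrDr; apply: lerD.
  apply: le_trans h1 _; rewrite ler_wpM2r // expr2 -mulrA.
  case: (n) => [|m]; first by rewrite !mul0r.
  rewrite ler_peMr // -[leLHS]mulr1; apply: ler_pM => //.
  by rewrite ler1n.
rewrite [leRHS](_ : _ = n%:R * (eps * (n%:R * (B * S)))); last by ring.
by rewrite !ler_wpM2l.
Qed.

Let NB := n%:R ^+ 2 * B.
(** With this weight the squared total surplus, at most [2 * n%:R ^+ 2 * M ^+ 2] up to errors, gives
    back exactly half of the decrease [2 * eps * qb * n%:R * M ^+ 2] won from [potx]. *)
Let kappa := qb / (2 * n%:R).

Definition lyap (y t : 'I_n -> R) := potx pi r eps y t + eps * kappa * pots h t.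

Hypothesis qb_gt0 : 0 < qb.
Hypothesis n_gt0 : (0 < n)%N.

Lemma mean_lyap : \sum_e p e * lyap (x' e) (s' e) <= lyap x s - dirichlet x
  - eps * (qb * n%:R) * `|M| ^+ 2 - eps * kappa * \sum_a s a ^+ 2
  + (C1 + 2 * qb * NB + kappa * (4 * NB ^+ 2 + 2 * n%:R * H)) * eps * Phi.
Proof.
have [e0 e1] := andP eps01; have B0 := le_trans ler01 B_ge1.
have N0 : 0 < n%:R :> R by rewrite ltr0n.
have kappa0 : 0 <= kappa by rewrite divr_ge0 ?mulr_ge0 // ltW.
have NB0 : 0 <= NB by rewrite mulr_ge0 // sqr_ge0.
have -> : \sum_e p e * lyap (x' e) (s' e) = \sum_e p e * potx pi r eps (x' e) (s' e)
   + eps * kappa * \sum_e p e * pots h (s' e).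
  by rewrite mulr_sumr -big_split /=; apply: eq_bigr => e _; rewrite /lyap; ring.
have sm := surplus_mean.
have dphi : `|M| * (d + eps * S) <= Phi.
  rewrite /Phi /errphi.
  have h1 : 0 <= d * S by rewrite mulr_ge0.
  have h2 : 0 <= eps * S ^+ 2 by rewrite mulr_ge0 // sqr_ge0.
  have h3 : 0 <= d ^+ 2 by rewrite sqr_ge0.
  lra.
have ddphi : (d + eps * S) ^+ 2 <= 2 * Phi.
  rewrite /Phi /errphi.
  have h1 : 0 <= `|M| * d by rewrite mulr_ge0.
  have h2 : 0 <= eps * `|M| * S by rewrite !mulr_ge0.
  have h3 : eps * (d * S) <= 1 * (d * S) by rewrite ler_wpM2r // mulr_ge0.
  have h4 : eps * (eps * S ^+ 2) <= 1 * (eps * S ^+ 2).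
    by rewrite ler_wpM2r // mulr_ge0 // sqr_ge0.
  have h5 : 0 <= d ^+ 2 by rewrite sqr_ge0.
  have h6 : 0 <= eps * S ^+ 2 by rewrite mulr_ge0 // sqr_ge0.
  lra.
set sg := \sum_a s a in sm *.
(* Substituting about [- n%:R * M] for the total surplus makes its pull on the mean dissipative. *)
have t1 : M * sg <= - n%:R * `|M| ^+ 2 + NB * Phi.
  have -> : M * sg = - n%:R * `|M| ^+ 2 + M * (sg + n%:R * M).
    by rewrite real_normK ?num_real //; ring.
  rewrite lerD2l; apply: le_trans (ler_norm _) _; rewrite normrM.
  apply: (@le_trans _ _ (`|M| * (NB * (d + eps * S)))); first by rewrite ler_wpM2l.
  by rewrite mulrCA ler_wpM2l.
have t2 : sg ^+ 2 <= 2 * n%:R ^+ 2 * `|M| ^+ 2 + 4 * NB ^+ 2 * Phi.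
  have u1 : (sg + n%:R * M) ^+ 2 <= NB ^+ 2 * (2 * Phi).
    rewrite -[leLHS]real_normK ?num_real //.
    apply: (@le_trans _ _ ((NB * (d + eps * S)) ^+ 2)).
      by rewrite ler_sqr ?nnegrE // !mulr_ge0 // addr_ge0 // mulr_ge0.
    by rewrite exprMn ler_wpM2l // sqr_ge0.
  rewrite real_normK ?num_real //.
  have := sqr_ge0 (sg + 2 * (n%:R * M)); move: u1; lra.
have m1 := mean_potx; have m2 := mean_pots.
rewrite -/sg in m1 m2.
have m3 : eps * kappa * (\sum_e p e * pots h (s' e)) <= eps * kappa *
  (pots h s - \sum_a s a ^+ 2 + (2 * n%:R ^+ 2 * `|M| ^+ 2 + 4 * NB ^+ 2 * Phi)
    + 2 * n%:R * H * Phi).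
  apply: ler_wpM2l; first by rewrite mulr_ge0.
  by apply: le_trans m2 _; rewrite lerD2r lerD2l.
have m4 : 2 * eps * M * (qb * sg) <= 2 * eps * qb * (- n%:R * `|M| ^+ 2 + NB * Phi).
  rewrite (_ : 2 * eps * M * (qb * sg) = 2 * eps * qb * (M * sg)); last by ring.
  by rewrite ler_wpM2l // !mulr_ge0 // ltW.
have kE : eps * kappa * (2 * n%:R ^+ 2 * `|M| ^+ 2) = eps * (qb * n%:R) * `|M| ^+ 2.
  rewrite /kappa; field; by rewrite gt_eqF.
apply: le_trans (lerD m1 m3) _; rewrite /lyap.
move: m4 kE; lra.
Qed.

End Drift.

(** The three losses in [mean_lyap] match the three squares of [small_gain]: the Dirichlet form
    through the Poincaré inequality, the other two directly. *)
Lemma lyapunov_exists (R : rcfType) (n : nat) (p w : 'I_n * 'I_n -> R) :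
  (forall e, 0 <= p e) -> \sum_e p e = 1 ->
  (forall u v, connect (fun a b => 0 < p (a, b)) u v) ->
  (forall e, 0 < p e -> e.1 != e.2) ->
  (forall e, 0 < p e -> 0 < w e < 1) ->
  exists2 epsb : R, 0 < epsb & forall eps : R, 0 < eps < epsb ->
  exists V : ('I_n -> R) -> ('I_n -> R) -> R, exists2 c : R, 0 < c &
    (forall x s, 0 <= V x s) /\
    forall (x s : 'I_n -> R) (x' s' : 'I_n * 'I_n -> 'I_n -> R),
    let D e := w e * (x e.1 - x e.2) + eps * w e * s e.2 in
    (forall e l, 0 < p e -> x' e l = x l + (l == e.2)%:R * D e) ->
    (forall e l, 0 < p e -> s' e l = push e s l - (l == e.2)%:R * D e) ->
    \sum_a x a + \sum_a s a = 0 ->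
    \sum_e p e * V (x' e) (s' e) <=
      V x s - c * (\sum_a x a ^+ 2 + \sum_a s a ^+ 2).
Proof.
move=> p_ge0 p_sum1 p_conn p_neq w01.
have p0 e : ~~ (0 < p e) -> p e = 0.
  by move=> h; apply/eqP; rewrite eq_le p_ge0 andbT leNgt.
have weighted (k : 'I_n * 'I_n -> R) :
    (forall e, 0 < p e -> 0 < k e) ->
    (forall e, 0 <= p e * k e) /\ (forall u v, connect (fun a b => 0 < p (a, b) * k (a, b)) u v).
  move=> k0; split=> [e|u v].
    have [/k0/ltW ke|/p0 ->] := boolP (0 < p e); by rewrite ?mul0r ?mulr_ge0.
  apply: connect_sub (p_conn u v) => a b pab; apply: connect1.
  by rewrite mulr_gt0 // k0.
have [e0 pe0] : exists e, 0 < p e.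
  apply/existsP; case: (boolP [exists e, 0 < p e]) => //.
  rewrite negb_exists => /forallP h.
  by move: p_sum1; rewrite big1 => [/eqP|e _]; [rewrite eq_sym oner_eq0|exact: p0].
have n_gt0 : (0 < n)%N by apply: leq_ltn_trans (ltn_ord e0.1).
have N0 : 0 < n%:R :> R by rewrite ltr0n.
have [c_ge0 c_conn] := weighted w (fun e pe => proj1 (andP (w01 e pe))).
have [pi [pi_gt0 pi_sum1 pi_stat]] := stationary_exists c_ge0 c_conn n_gt0.
have pi_ge0 a : 0 <= pi a by exact: ltW.
(* Mean rate at which surplus at [a] feeds the [pi]-mean of [x]: only edges received by [a]
   count. *)
pose q a := \sum_e p e * ((a == e.2)%:R * (w e * pi a)).
have q_ge0' a e : true -> 0 <= p e * ((a == e.2)%:R * (w e * pi a)).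
  move=> _; have [/w01/andP[/ltW we _]|/p0 ->] := boolP (0 < p e); last by rewrite mul0r.
  by rewrite !mulr_ge0.
have q_ge0 a : 0 <= q a by apply: sumr_ge0 => e; exact: q_ge0'.
have q_gt0 : 0 < q e0.2.
  rewrite /q (bigD1 e0) //= ltr_wpDr ?sumr_ge0 // => [e _|]; first exact: q_ge0'.
  by rewrite eqxx mul1r !mulr_gt0 //; case/andP: (w01 _ pe0).
have [r [qb [qb_gt0 r_poisson]]] := poisson_exists p_ge0 p_conn p_sum1 q_ge0 q_gt0.
have [h [h_ge0 h_diag h_coal]] := coalescence_exists p_ge0 p_conn p_sum1.
have [k_ge0 k_conn] := weighted (fun e => pi e.2 * w e * (1 - w e))
  (fun e pe => mulr_gt0 (mulr_gt0 (pi_gt0 _) (proj1 (andP (w01 e pe))))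
     (etrans (subr_gt0 _ _) (proj2 (andP (w01 e pe))))).
have [K K_gt0 Poinc] := poincare k_ge0 k_conn.
pose B := 1 + \sum_a `|r a|; pose H := \sum_a \sum_b h a b.
have B_ge1 : 1 <= B by rewrite lerDl sumr_ge0.
have B_ge0 := le_trans ler01 B_ge1.
have rB a : `|r a| <= B.
  by rewrite /B (bigD1 a) //= addrCA lerDl addr_ge0 // sumr_ge0.
have H_ge0 : 0 <= H by apply: sumr_ge0 => a _; apply: sumr_ge0.
have hH a b : h a b <= H.
  rewrite /H (bigD1 a) //= (bigD1 b) //= -addrA lerDl addr_ge0 ?sumr_ge0 // => i _.
  by rewrite sumr_ge0.
pose kappa := qb / (2 * n%:R).
have kappa_gt0 : 0 < kappa by rewrite divr_gt0 // mulr_gt0.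
pose C := 9 + 2 * B + 4 * ((2 * n%:R + 1) * B) + 2 * ((2 * n%:R + 1) * B) ^+ 2
   + 2 * qb * (n%:R ^+ 2 * B) + kappa * (4 * (n%:R ^+ 2 * B) ^+ 2 + 2 * n%:R * H).
have C_ge0 : 0 <= C.
  have qb_ge0 := ltW qb_gt0; have kappa_ge0 := ltW kappa_gt0.
  by rewrite /C; do !(done || apply: sqr_ge0 || apply: mulr_ge0 || apply: addr_ge0).
(* The smallest of the three loss coefficients. *)
pose g := Num.min K^-1 (Num.min (qb * n%:R) kappa).
have g_gt0 : 0 < g by rewrite !lt_min invr_gt0 K_gt0 kappa_gt0 mulr_gt0.
have g1 : g <= K^-1 by rewrite ge_min lexx.
have g2 : g <= qb * n%:R by rewrite !ge_min lexx orbT.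
have g3 : g <= kappa by rewrite !ge_min lexx !orbT.
have [epsb /andP[epsb0 epsb1] gain] := small_gain g_gt0 C_ge0.
exists epsb => // eps epsP; have /andP[eps0 epslt] := epsP.
have eps01 : 0 <= eps <= 1 by rewrite ltW //= (le_trans (ltW epslt)).
(* Converts [M ^+ 2 + d ^+ 2 + S ^+ 2] into a bound on the energy: [3 * (1 + n%:R ^+ 2 * B ^+ 2)]
   for each of the [n] squares of [x], and 1 for the surpluses. *)
pose K' := 3 * n%:R * (1 + n%:R ^+ 2 * B ^+ 2) + 1 : R.
have K'_gt0 : 0 < K'.
  apply: ltr_wpDl => //.
  by do !(done || apply: sqr_ge0 || apply: mulr_ge0 || apply: addr_ge0).
exists (lyap pi r qb h eps), (eps * g / 2 / K').
  by rewrite !divr_gt0 // mulr_gt0.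
split=> [x s|x s x' s' D x'E s'E sum0].
  rewrite addr_ge0 //; last first.
    exact: mulr_ge0 (mulr_ge0 (ltW eps0) (ltW kappa_gt0)) (pots_ge0 h_ge0 s).
  by apply: sumr_ge0 => a _; rewrite mulr_ge0 // sqr_ge0.
(* Euclidean sizes: they bound every entry, and their squares are exactly the sums needed. *)
pose d := Num.sqrt (\sum_a \sum_b (x a - x b) ^+ 2).
pose S := Num.sqrt (\sum_a s a ^+ 2).
have dd : d ^+ 2 = \sum_a \sum_b (x a - x b) ^+ 2.
  by rewrite sqr_sqrtr // sumr_ge0 // => a _; rewrite sumr_ge0 // => b _; rewrite sqr_ge0.
have SS : S ^+ 2 = \sum_a s a ^+ 2.
  by rewrite sqr_sqrtr // sumr_ge0 // => a _; rewrite sqr_ge0.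
have d_ge0 : 0 <= d by exact: sqrtr_ge0.
have S_ge0 : 0 <= S by exact: sqrtr_ge0.
have xd a b : `|x a - x b| <= d.
  rewrite -sqrtr_sqr ler_wsqrtr // (bigD1 a) //= (bigD1 b) //= -addrA lerDl.
  rewrite addr_ge0 ?sumr_ge0 // => i _; rewrite ?sqr_ge0 //.
  by rewrite sumr_ge0 // => j _; rewrite sqr_ge0.
have sS a : `|s a| <= S.
  rewrite -sqrtr_sqr ler_wsqrtr // (bigD1 a) //= lerDl sumr_ge0 // => i _.
  by rewrite sqr_ge0.
have w01' e : 0 < p e -> 0 <= w e <= 1.
  by move=> /w01/andP[/ltW -> /ltW ->].
have main := @mean_lyap R n p w pi r qb h p_ge0 p_sum1 p_neq w01' pi_ge0 pi_sum1
  pi_stat r_poisson h_ge0 h_diag h_coal eps d S B H x s x' s' x'E s'E eps01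
  d_ge0 S_ge0 B_ge1 H_ge0 xd sS rB hH sum0 qb_gt0 n_gt0.
apply: le_trans main _; rewrite -SS -/kappa -/C.
set M := wmean pi r eps x s.
have M0 : 0 <= `|M| by [].
have {gain} := gain eps epsP _ _ _ M0 d_ge0 S_ge0.
rewrite -/(errphi eps d S `|M|) => gain.
have dir : g * d ^+ 2 <= dirichlet p w pi x.
  apply: (@le_trans _ _ (K^-1 * d ^+ 2)); first by rewrite ler_wpM2r // sqr_ge0.
  rewrite ler_pdivrMl // dd; apply: le_trans (Poinc x) _.
  rewrite /dirichlet ler_pM2l // ler_sum // => e _.
  by rewrite mulrA.
have gM : g * (eps * `|M| ^+ 2) <= eps * (qb * n%:R) * `|M| ^+ 2.
  by rewrite mulrA [g * _]mulrC ler_wpM2r ?sqr_ge0 // ler_wpM2l // ltW.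
have gS : g * (eps * S ^+ 2) <= eps * kappa * S ^+ 2.
  by rewrite mulrA [g * _]mulrC ler_wpM2r ?sqr_ge0 // ler_wpM2l // ltW.
have nrm : \sum_a x a ^+ 2 + S ^+ 2 <= K' * (`|M| ^+ 2 + d ^+ 2 + S ^+ 2).
  have rS : `|\sum_a r a * s a| <= n%:R * (B * S).
    apply: le_trans (ler_norm_sum _ _ _) _.
    have -> : n%:R * (B * S) = \sum_(a < n) (B * S) by rewrite sumr_const card_ord mulr_natl.
    by apply: ler_sum => a _; rewrite normrM ler_pM.
  have xa a : x a ^+ 2 <= 3 * (1 + n%:R ^+ 2 * B ^+ 2) * (`|M| ^+ 2 + d ^+ 2 + S ^+ 2).
    have h1 : `|x a| <= `|M| + d + n%:R * (B * S).
      have -> : x a = M + (corr r eps x s a - M) - eps * \sum_a r a * s a.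
        by rewrite /corr; ring.
      apply: le_trans (ler_normB _ _) _; apply: lerD.
        apply: le_trans (ler_normD _ _) _; rewrite lerD2l; exact: corr_wmean.
      rewrite normrM (ger0_norm (ltW eps0)) -[leRHS]mul1r.
      by case/andP: eps01 => ? ?; apply: ler_pM.
    rewrite -[leLHS]real_normK ?num_real //.
    apply: (@le_trans _ _ ((`|M| + d + n%:R * (B * S)) ^+ 2)).
      by rewrite ler_sqr ?nnegrE // !addr_ge0 // !mulr_ge0.
    have a1 := sqr_ge0 (`|M| - d); have a2 := sqr_ge0 (d - n%:R * (B * S)).
    have a3 := sqr_ge0 (`|M| - n%:R * (B * S)).
    have a4 : 0 <= n%:R ^+ 2 * B ^+ 2 * (`|M| ^+ 2 + d ^+ 2).
      by do !(done || apply: sqr_ge0 || apply: mulr_ge0 || apply: addr_ge0).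
    have a5 := sqr_ge0 S.
    move: a1 a2 a3 a4 a5; rewrite -/M; lra.
  apply: (@le_trans _ _ (\sum_(a < n) 3 * (1 + n%:R ^+ 2 * B ^+ 2) *
     (`|M| ^+ 2 + d ^+ 2 + S ^+ 2) + S ^+ 2)).
    by rewrite lerD2r ler_sum.
  rewrite sumr_const card_ord -(mulr_natl (_ * _)) /K'.
  have := sqr_ge0 d; have := sqr_ge0 `|M|; lra.
have nrm' : eps * g / 2 / K' * (\sum_a x a ^+ 2 + S ^+ 2) <=
    eps * g / 2 * (`|M| ^+ 2 + d ^+ 2 + S ^+ 2).
  rewrite -[leLHS]mulrA ler_pM2l ?divr_gt0 ?mulr_gt0 //.
  by rewrite ler_pdivrMl.
move: gain dir gM gS nrm'.
move: (errphi _ _ _ _) (dirichlet _ _ _ _) (lyap _ _ _ _ _ _ _) (_ / K' * _).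
move=> t1 t2 t3 t4; lra.
Qed.

(** * Almost sure convergence *)

Local Open Scope classical_set_scope.
Local Open Scope ring_scope.

Section Expectation.
Context (d : measure_display) (T : measurableType d) (R : realType).
Variables (P : probability T R) (n : nat) (E : {set 'I_n * 'I_n}).
Variables (p w : 'I_n -> 'I_n -> R) (eps : R) (x0 : 'I_n -> R).
Variable (ev : nat -> T -> 'I_n * 'I_n).
Hypothesis iid : iid_edges P ev E p.
Implicit Types (a : nat -> 'I_n * 'I_n) (e : 'I_n * 'I_n) (f : gstate R n -> R).

Local Notation edge := ('I_n * 'I_n)%type.
Local Notation state := (gossip_state w eps x0).

(** Expectation of [f] after [k] independent steps from [z], as finite sums conditioned on the first
    step; no conditional expectation on [T] is used. *)
Fixpoint mean_iter f k (z : gstate R n) : R :=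
  match k with
  | 0 => f z
  | k'.+1 => \sum_e edge_prob E p e * mean_iter f k' (gossip_step w eps z e)
  end.

Lemma gossip_state_eq (es es' : nat -> edge) k :
  (forall m, (m < k)%N -> es m = es' m) -> state es k = state es' k.
Proof.
elim: k => //= k IH h; rewrite IH ?h // => m mk; exact: h (ltnW mk).
Qed.

Definition cyl k a : set T := [set t | forall m, (m < k)%N -> ev m t = a m].

Lemma measurable_cyl k a : measurable (cyl k a).
Proof.
elim: k => [|k IH].
  by rewrite (_ : cyl 0 a = setT) //; apply/seteqP; split.
rewrite (_ : cyl k.+1 a = cyl k a `&` ev k @^-1` [set a k]).
  by apply: measurableI => //; exact: iid.1.
apply/seteqP; split => t /=.
  by move=> h; split => [m mk|]; apply: h => //; exact: ltnW.
move=> [h hk] m; rewrite ltnS leq_eqVlt => /orP[/eqP -> //|]; exact: h.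
Qed.

Definition upd a k e : nat -> edge := fun m => if m == k then e else a m.

Lemma cyl_updE k a e t : cyl k.+1 (upd a k e) t <-> cyl k a t /\ ev k t = e.
Proof.
split=> [h|[h hk] m].
  split=> [m mk|]; last by rewrite h // /upd eqxx.
  by rewrite (h m (ltnW mk)) /upd (ltn_eqF mk).
rewrite ltnS leq_eqVlt /upd => /orP[/eqP ->|mk]; first by rewrite eqxx.
by rewrite ltn_eqF // h.
Qed.

Lemma cyl_split k a :
  cyl k a = \big[setU/set0]_(e <- index_enum edge) cyl k.+1 (upd a k e).
Proof.
rewrite -bigcup_seq; apply/seteqP; split => t /=.
  by move=> h; exists (ev k t) => /=; [exact: mem_index_enum|exact/cyl_updE].
by move=> [e _ /cyl_updE[]].
Qed.

Definition obs f k t : \bar R := (f (state (ev ^~ t) k))%:E.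

(** Induction on the number [j] of steps left: the state is constant on a cylinder when [j = 0], and
    otherwise the cylinder splits according to its next edge. Measurability follows from the same
    finite splitting. *)
Lemma integral_mean_iter f : (forall z, 0 <= f z) -> forall j k a,
  measurable_fun (cyl k a) (obs f (k + j)) /\
  (\int[P]_(t in cyl k a) obs f (k + j) t =
   (\prod_(m < k) edge_prob E p (a m) * mean_iter f j (state a k))%:E)%E.
Proof.
move=> f_ge0; elim=> [|j IH] k a.
  have cst_on : {in cyl k a, cst (f (state a k))%:E =1 obs f (k + 0)}.
    move=> t; rewrite inE => h /=; congr ((f _)%:E); rewrite addn0.
    by apply: gossip_state_eq => m mk; rewrite h.
  split; first by apply: eq_measurable_fun cst_on _; exact: measurable_cst.
  rewrite -(eq_integral _ _ cst_on) integral_cst; last exact: measurable_cyl.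
  by rewrite [X in (_ * X)%E](iid.2 k a) -EFinM mulrC.
have IHe e := IH k.+1 (upd a k e).
have mf : measurable_fun (cyl k a) (obs f (k + j.+1)).
  move=> _ A mA; rewrite cyl_split -bigcup_seq setI_bigcupl.
  apply: fin_bigcup_measurable => // e _; rewrite addnS -addSn.
  exact: (IHe e).1 (measurable_cyl _ _) _ mA.
split=> //; rewrite {1}cyl_split ge0_integral_bigsetU //.
- rewrite /= mulr_sumr -sumEFin; apply: eq_bigr => e _.
  rewrite addnS -addSn (IHe e).2 big_ord_recr /= /upd eqxx -!mulrA.
  congr ((_ * (_ * mean_iter f j (gossip_step _ _ _ _)))%:E).
    by apply: eq_bigr => m _; rewrite ltn_eqF.
  by apply: gossip_state_eq => m mk; rewrite ltn_eqF.
- by move=> e; exact: measurable_cyl.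
- exact: index_enum_uniq.
- move=> e1 e2 _ _ [t [/cyl_updE[_ <-] /cyl_updE[_ <-]]] //.
- by rewrite -cyl_split.
- by move=> t _; rewrite lee_fin.
Qed.

(** The integral of the series is the series of the integrals, at most [C]. Hence the series is
    finite almost everywhere and its terms tend to zero. *)
Lemma ae_cvg0 f (C : R) : (forall z, 0 <= f z) ->
  (forall K, \sum_(k < K) mean_iter f k (x0, fun=> 0) <= C) ->
  {ae P, forall t, (fun k => f (state (ev ^~ t) k)) @ \oo --> (0 : R)}.
Proof.
move=> f_ge0 sumC.
pose u := obs f.
have cyl0 a : cyl 0 a = setT by apply/seteqP; split.
(* Any edge sequence serves, since the cylinder of length 0 is the whole space; as [n] may be 0
   here, an edge is taken from a value of [ev]. *)
have a0 : nat -> edge := fun _ => ev 0 point.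
have mu k : measurable_fun setT (u k).
  by have := (integral_mean_iter f_ge0 k 0 a0).1; rewrite cyl0.
have intu k : (\int[P]_t u k t = (mean_iter f k (x0, fun=> 0))%:E)%E.
  by have := (integral_mean_iter f_ge0 k 0 a0).2; rewrite cyl0 big_ord0 mul1r.
have u_ge0 k t : (0 <= u k t)%E by rewrite lee_fin.
have int_sum : (\int[P]_t (\sum_(0 <= k <oo) u k t) <= C%:E)%E.
  rewrite integral_nneseries //.
  apply: lime_le; first by apply: is_cvg_nneseries => k _ _; exact: integral_ge0.
  apply: nearW => K; under eq_bigr do rewrite intu.
  by rewrite big_mkord sumEFin lee_fin.
have msum : measurable_fun setT (fun t => (\sum_(0 <= k <oo) u k t)%E).
  exact: ge0_emeasurable_sum.
have isum : P.-integrable setT (fun t => (\sum_(0 <= k <oo) u k t)%E).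
  apply/integrableP; split => //.
  under eq_integral => t _ do rewrite gee0_abs ?nneseries_ge0 //.
  exact: le_lt_trans int_sum (ltry _).
have := integrable_ae measurableT isum.
apply: filterS => t /(_ I) fin.
have bnd K : \sum_(0 <= k < K) f (state (ev ^~ t) k) <= fine (\sum_(0 <= k <oo) u k t)%E.
  rewrite -lee_fin fineK // -sumEFin.
  by apply: (@nneseries_lim_ge R (u ^~ t) xpredT 0 K) => k _ _; exact: u_ge0.
apply: cvg_series_cvg_0; apply: nondecreasing_is_cvgn.
  by apply/nondecreasing_series => k _ _; exact: f_ge0.
exists (fine (\sum_(0 <= k <oo) u k t)%E) => _ [K _ <-]; exact: bnd.
Qed.

End Expectation.

(** * Strong connectivity implies consensus *)

Section Consensus.
Variables (R : realType) (n : nat) (E : {set 'I_n * 'I_n}) (p w : 'I_n -> 'I_n -> R).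
Hypothesis no_loop : forall i : 'I_n, (i, i) \notin E.
Hypothesis p_gt0 : forall j i : 'I_n, (j, i) \in E -> 0 < p i j < 1.
Hypothesis p_sum : \sum_(e in E) p e.2 e.1 = 1.
Hypothesis w01 : forall j i : 'I_n, (j, i) \in E -> 0 < w i j < 1.

Local Notation pe := (edge_prob E p).

Lemma edge_prob_gt0 e : (0 < pe e) = (e \in E).
Proof.
rewrite /edge_prob; case: ifP => [|_]; last by rewrite ltxx.
by case: e => j i /p_gt0/andP[].
Qed.

Lemma edge_prob_ge0 e : 0 <= pe e.
Proof.
have [h|] := boolP (e \in E); first by rewrite ltW // edge_prob_gt0.
by rewrite /edge_prob => /negbTE ->.
Qed.

Lemma edge_prob_sum1 : \sum_e pe e = 1.
Proof. by rewrite -[RHS]p_sum [RHS]big_mkcond. Qed.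

Lemma edge_neq e : e \in E -> e.1 != e.2.
Proof.
by case: e => j i eE /=; apply: contraTN eE => /eqP ->; exact: no_loop.
Qed.

Definition increment eps (x s : 'I_n -> R) (e : 'I_n * 'I_n) : R :=
  w e.2 e.1 * (x e.1 - x e.2) + eps * w e.2 e.1 * s e.2.

Lemma gossip_step1 eps x s e l :
  (gossip_step w eps (x, s) e).1 l = x l + (l == e.2)%:R * increment eps x s e.
Proof.
case: e => j i /=; rewrite /increment /=; case: eqVneq => [->|_] /=; ring.
Qed.

Lemma gossip_step2 eps x s e l :
  (gossip_step w eps (x, s) e).2 l = push e s l - (l == e.2)%:R * increment eps x s e.
Proof.
case: e => j i /=; rewrite /increment /push /=; case: eqVneq => [_|_] /=; first by ring.
by rewrite mul0r subr0.
Qed.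

Definition total (z : gstate R n) := \sum_l z.1 l + \sum_l z.2 l.

Lemma total_step eps z e : e \in E -> total (gossip_step w eps z e) = total z.
Proof.
case: z => x s eE; rewrite /total.
under eq_bigr do rewrite gossip_step1.
under [X in _ + X]eq_bigr do rewrite gossip_step2.
rewrite big_split /= sumrB.
have -> : \sum_l push e s l = \sum_l s l.
  rewrite (eq_bigr (fun l => 1 * push e s l)) => [|l _]; last by rewrite mul1r.
  rewrite (sum_push s (fun=> 1) (edge_neq eE)).
  by apply: eq_bigr => l _; rewrite mul1r.
by rewrite addrACA subrr addr0.
Qed.

Definition energy (z : gstate R n) := \sum_l z.1 l ^+ 2 + \sum_l z.2 l ^+ 2.

Lemma energy_ge0 z : 0 <= energy z.
Proof. by rewrite addr_ge0 // sumr_ge0 // => l _; rewrite sqr_ge0. Qed.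

(** States enter the updates only through differences, so the algorithm commutes with
    translations. *)
Lemma gossip_state_shift eps x0 c es k :
  gossip_state w eps (fun l => x0 l - c) es k =
  ((fun l => (gossip_state w eps x0 es k).1 l - c), (gossip_state w eps x0 es k).2).
Proof.
elim: k => //= k ->; move: (gossip_state _ _ _ _ _) => [x s] /=; case: (es k) => j i.
congr (_, _); apply/funext => l /=.
  by case: ifP => // _; ring.
by case: ifP => // _; ring.
Qed.

Lemma cvg0_sqr_le (u v : nat -> R) : (forall k, u k ^+ 2 <= v k) ->
  v @ \oo --> (0 : R) -> u @ \oo --> (0 : R).
Proof.
move=> uv /cvgr0Pnorm_lt v0; apply/cvgr0Pnorm_lt => e e0.
have := v0 (e ^+ 2) (exprn_gt0 2 e0); apply: filterS => k vk.
have : `|u k| ^+ 2 < e ^+ 2.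
  rewrite real_normK ?num_real //; apply: le_lt_trans (uv k) _.
  exact: le_lt_trans (ler_norm _) vk.
by rewrite ltr_sqr ?nnegrE // (ltW e0).
Qed.

Lemma strongly_connected_consensus : strongly_connected E ->
  exists epsb : R, 0 < epsb /\
    forall eps : R, 0 < eps < epsb -> as_average_consensus E p w eps.
Proof.
move=> sc.
have conn u v : connect (fun a b => 0 < pe (a, b)) u v.
  apply: connect_sub (sc u v) => a b ab; apply: connect1.
  by rewrite edge_prob_gt0.
have neq e : 0 < pe e -> e.1 != e.2 by rewrite edge_prob_gt0; exact: edge_neq.
have w01' e : 0 < pe e -> 0 < w e.2 e.1 < 1.
  by rewrite edge_prob_gt0; case: e => j i; exact: w01.
have [epsb epsb0 lyap_ex] := lyapunov_exists edge_prob_ge0 edge_prob_sum1 conn neq w01'.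
exists epsb; split=> // eps /lyap_ex[V [c c0 [V_ge0 V_dec]]] d T P ev iid x0 xa.
(* The telescoped decrease of [V], by induction on the number of terms: the first step is split off
   and the bound applied to each successor, whose total is again zero. *)
have energy_sum K z : total z = 0 ->
    \sum_(k < K) mean_iter E p w eps energy k z <= V z.1 z.2 / c.
  elim: K z => [|K IH] z tz; first by rewrite big_ord0 divr_ge0 // ltW.
  rewrite big_ord_recl /=.
  rewrite exchange_big /=.
  have -> : \sum_e \sum_(k < K) pe e * mean_iter E p w eps energy k (gossip_step w eps z e)
     = \sum_e pe e * \sum_(k < K) mean_iter E p w eps energy k (gossip_step w eps z e).
    by apply: eq_bigr => e _; rewrite mulr_sumr.
  case: z tz => x s tz.
  pose z' e := gossip_step w eps (x, s) e.
  apply: (@le_trans _ _ (energy (x, s) + \sum_e pe e * (V (z' e).1 (z' e).2 / c))).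
    rewrite lerD2l; apply: (le_mean edge_prob_ge0) => e.
    by rewrite edge_prob_gt0 => eE; apply: IH; rewrite total_step.
  have := V_dec x s (fun e => (z' e).1) (fun e => (z' e).2)
    (fun e l _ => gossip_step1 eps x s e l) (fun e l _ => gossip_step2 eps x s e l) tz.
  rewrite -[\sum_a x a ^+ 2 + _]/(energy (x, s)) => dec.
  under eq_bigr do rewrite mulrA.
  rewrite -mulr_suml ler_pdivlMr // mulrDl divfK ?gt_eqF //.
  by move: dec; rewrite [c * _]mulrC; lra.
(* Centring brings the start into the zero-total subspace, where [V] decreases. *)
pose y0 l := x0 l - xa.
have ty0 : total (y0, fun=> 0) = 0.
  rewrite /total /= sumrB [X in _ + X]big1 // addr0 sumr_const card_ord.
  case: (posnP n) => [n0|n0].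
    rewrite /xa; apply/eqP; rewrite subr_eq0; apply/eqP.
    by move: n0 (x0) => ->; move=> y; rewrite big_ord0 mulr0n.
  by rewrite -mulr_natr /xa divfK ?subrr // pnatr_eq0 -lt0n.
have := ae_cvg0 iid energy_ge0 (fun K => energy_sum K _ ty0).
apply: filterS => t cvg0 l.
have shift k : gossip_state w eps y0 (ev ^~ t) k = _ :=
  gossip_state_shift eps x0 xa (ev ^~ t) k.
split.
  have : (fun k => (gossip_state w eps y0 (ev ^~ t) k).1 l) @ \oo --> (0 : R).
    apply: cvg0_sqr_le cvg0 => k; rewrite /energy (bigD1 l) //= -addrA lerDl.
    by rewrite addr_ge0 // sumr_ge0 // => i _; rewrite sqr_ge0.
  move=> /(cvgD (cvg_cst xa)); rewrite addr0; apply: cvg_trans.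
  by apply: near_eq_cvg; apply: nearW => k; rewrite !fctE shift /= addrC subrK.
have : (fun k => (gossip_state w eps y0 (ev ^~ t) k).2 l) @ \oo --> (0 : R).
  apply: cvg0_sqr_le cvg0 => k.
  rewrite /energy [X in _ + X](bigD1 l) //= addrCA lerDl.
  by rewrite addr_ge0 // sumr_ge0 // => i _; rewrite sqr_ge0.
by apply: cvg_trans; apply: near_eq_cvg; apply: nearW => k; rewrite /= shift.
Qed.

End Consensus.

(** * An i.i.d. sequence on the unit interval, and the converse *)

Section UnitMeasure.
Variable R : realType.

Definition unit_measure : set (measurableTypeR R) -> \bar R :=
  mrestr (@lebesgue_measure R) (measurable_itv `[0, 1[).

HB.instance Definition _ := Measure.on unit_measure.

Lemma unit_measureE (lo len : R) (A : set (measurableTypeR R)) :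
  0 <= len -> A `&` `[0, 1[%classic = `[lo, lo + len[%classic ->
  unit_measure A = len%:E.
Proof.
move=> len0 AE; rewrite /unit_measure /mrestr AE lebesgue_measure_itv /= lte_fin.
case: ltP => [_|]; first by rewrite -EFinB addrC addKr.
by rewrite gerDl => len0'; congr (_%:E); apply/eqP; rewrite eq_le len0 len0'.
Qed.

Lemma unit_measureT : unit_measure setT = 1%E.
Proof. by apply: (@unit_measureE 0) => //; rewrite setTI add0r. Qed.

HB.instance Definition _ :=
  Measure_isProbability.Build _ _ _ unit_measure unit_measureT.

End UnitMeasure.

(** * Independent digits of a uniform number, with a prescribed law *)

Section Digits.
Variables (R : realType) (I : finType) (q : I -> R) (e0 : I).
Hypothesis q_ge0 : forall e, 0 <= q e.
Hypothesis q_sum1 : \sum_e q e = 1.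
Hypothesis q_e0 : 0 < q e0.

Definition cdf (k : nat) : R := \sum_(e | (enum_rank e < k)%N) q e.

Lemma cdf_le j k : (j <= k)%N -> cdf j <= cdf k.
Proof.
move=> jk; rewrite /cdf [leLHS]big_mkcond [leRHS]big_mkcond /=.
apply: ler_sum => e _; case: ifP => [ej|_]; last by case: ifP.
by rewrite (leq_trans ej jk).
Qed.

Lemma cdf_rank e : cdf (enum_rank e).+1 = cdf (enum_rank e) + q e.
Proof.
rewrite /cdf (bigD1 e) //= addrC; congr (_ + _); apply: eq_bigl => e'.
rewrite ltnS leq_eqVlt; have [->|ee'] := eqVneq e' e; first by rewrite ltnn andbF.
by rewrite andbT -[X in X || _]/(enum_rank e' == enum_rank e) (inj_eq enum_rank_inj) (negbTE ee').
Qed.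

(** The cells cut the unit interval into consecutive intervals of lengths [q e]; a symbol of
    probability zero has an empty cell. *)
Definition in_cell e (t : R) := cdf (enum_rank e) <= t < cdf (enum_rank e) + q e.

Lemma in_cell_inj e e' t : in_cell e t -> in_cell e' t -> e = e'.
Proof.
rewrite /in_cell -!cdf_rank => /andP[a1 a2] /andP[b1 b2].
apply: enum_rank_inj; apply: val_inj; apply/eqP.
rewrite eqn_leq; apply/andP; split; rewrite leqNgt; apply/negP => /cdf_le h.
  by have := lt_le_trans b2 (le_trans h a1); rewrite ltxx.
by have := lt_le_trans a2 (le_trans h b1); rewrite ltxx.
Qed.

Lemma in_cell_ex t : 0 <= t < 1 -> exists e, in_cell e t.
Proof.
move=> /andP[t0 t1].
have ex : exists k, t < cdf k.
  exists #|I|; rewrite (_ : cdf _ = 1) // -q_sum1; apply: eq_bigl => e.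
  by rewrite ltn_ord.
have cdf0 : cdf 0 = 0 by rewrite /cdf big_pred0.
case: (ex_minnP ex) => -[|k] tk kmin; first by move: tk; rewrite cdf0 ltNge t0.
have ck : cdf k <= t.
  by rewrite leNgt; apply/negP => /kmin; rewrite ltnn.
have kI : (k < #|I|)%N.
  rewrite ltnNge; apply/negP => Ik.
  suff : cdf k = cdf k.+1 by move=> E; move: tk; rewrite -E ltNge ck.
  apply: eq_bigl => e; have ei := leq_trans (ltn_ord (enum_rank e)) Ik.
  by rewrite ei ltnS (ltnW ei).
exists (enum_val (Ordinal kI)).
by rewrite /in_cell -cdf_rank enum_valK /= ck.
Qed.

Definition digit t := odflt e0 [pick e | in_cell e t].

Lemma digitE t e : 0 <= t < 1 -> (digit t == e) = in_cell e t.
Proof.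
move=> t01; rewrite /digit; case: pickP => [e' e't|none] /=.
  by apply/eqP/idP => [<- //|]; exact: in_cell_inj.
by have [e' ] := in_cell_ex t01; rewrite none.
Qed.

Lemma digit_gt0 t : 0 < q (digit t).
Proof.
rewrite /digit; case: pickP => //= e /andP[a b].
by have := le_lt_trans a b; rewrite ltrDl.
Qed.

(** Stretches the cell containing [t] affinely onto the unit interval, as multiplication by the base
    modulo 1 does for ordinary digits. *)
Definition digit_shift t := (t - cdf (enum_rank (digit t))) / q (digit t).

Lemma digit_shift01 t : 0 <= t < 1 -> 0 <= digit_shift t < 1.
Proof.
move=> t01; have : in_cell (digit t) t by rewrite -digitE.
move=> /andP[a b]; rewrite /digit_shift divr_ge0 ?subr_ge0 //=.
by rewrite ltr_pdivrMr ?digit_gt0 // mul1r ltrBlDl.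
Qed.

Definition digits k t := digit (iter k digit_shift t).

(** Prescribing one more leading digit pulls an interval back through an affine branch of
    [digit_shift], which scales its length by the probability of that digit. *)
Lemma digits_cyl k (a : nat -> I) : exists lo : R,
  [/\ 0 <= lo, lo + \prod_(m < k) q (a m) <= 1 & forall t, 0 <= t < 1 ->
    (forall m, (m < k)%N -> digits m t = a m) <->
    lo <= t < lo + \prod_(m < k) q (a m)].
Proof.
elim: k a => [|k IH] a.
  by exists 0; rewrite big_ord0 add0r; split.
have [lo [lo0 lo1 loE]] := IH (fun m => a m.+1).
set Pi := \prod_(m < k) _ in lo1 loE.
have Pi0 : 0 <= Pi by apply: prodr_ge0.
pose c := cdf (enum_rank (a 0%N)).
exists (c + q (a 0%N) * lo); rewrite big_ord_recl /= -/Pi.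
have c0 : 0 <= c by apply: sumr_ge0.
split.
- by rewrite addr_ge0 // mulr_ge0.
- rewrite -addrA -mulrDr; apply: (@le_trans _ _ (c + q (a 0%N))).
    by rewrite lerD2l ler_piMr.
  rewrite /c -cdf_rank -q_sum1 /cdf.
  rewrite [leRHS](bigID (fun e => (enum_rank e < (enum_rank (a 0%N)).+1)%N)) /=.
  by rewrite lerDl sumr_ge0.
move=> t t01.
have -> : (forall m, (m < k.+1)%N -> digits m t = a m) <->
    digit t = a 0%N /\ (forall m, (m < k)%N -> digits m (digit_shift t) = a m.+1).
  split=> [h|[h0 h] [_|m mk]].
  - by split=> [|m mk]; [exact: (h 0%N)|rewrite /digits -iterSr; exact: (h m.+1)].
  - exact: h0.
  - by rewrite /digits iterSr; exact: h.
rewrite loE ?digit_shift01 //.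
(* For a digit of probability zero both sides are false: it never occurs, and the interval is
   empty. *)
have [q0|q_neq0] := eqVneq (q (a 0%N)) 0.
  rewrite q0 !mul0r !addr0; split=> [[dt _]|/andP[h1 h2]].
    by have := digit_gt0 t; rewrite dt q0 ltxx.
  by have := le_lt_trans h1 h2; rewrite ltxx.
have q_gt0 : 0 < q (a 0%N) by rewrite lt_neqAle eq_sym q_neq0 q_ge0.
have shiftE : digit t = a 0%N ->
    (lo <= digit_shift t < lo + Pi) = (c + q (a 0%N) * lo <= t < c + q (a 0%N) * lo + q (a 0%N) * Pi).
  move=> dt; rewrite /digit_shift dt -/c ler_pdivlMr // ltr_pdivrMr //.
  rewrite lerBrDl ltrBlDl mulrDl addrA.
  by rewrite [lo * _]mulrC [Pi * _]mulrC.
split=> [[dt]|h]; first by rewrite shiftE.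
have dt : digit t = a 0%N.
  apply/eqP; rewrite digitE // /in_cell -/c; case/andP: h => h1 h2.
  apply/andP; split; first by apply: le_trans h1; rewrite lerDl mulr_ge0.
  apply: lt_le_trans h2 _; rewrite -addrA -mulrDr lerD2l ler_piMr //.
by split=> //; rewrite shiftE.
Qed.

(* Off [0, 1[, a null set, any edge of positive probability will do. *)
Definition digit_seq k (t : measurableTypeR R) : I :=
  if 0 <= t < 1 then digits k t else e0.

Lemma digit_seq_cyl k (a : nat -> I) : exists lo : R,
  [set t | forall m, (m < k)%N -> digit_seq m t = a m] `&` `[0, 1[%classic =
  `[lo, lo + \prod_(m < k) q (a m)[%classic.
Proof.
have [lo [lo0 lo1 loE]] := digits_cyl k a; exists lo.
apply/seteqP; split => t /=; rewrite !in_itv /=.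
  move=> [h t01]; apply/loE => // m mk; rewrite -h //.
  by rewrite /digit_seq t01.
move=> h; have t01 : 0 <= t < 1.
  by case/andP: h => h1 h2; rewrite (le_trans lo0) //= (lt_le_trans h2).
split=> // m mk; rewrite /digit_seq t01; exact: (proj2 (loE t t01)).
Qed.

Lemma digit_seq_prob k (a : nat -> I) :
  unit_measure [set t | forall m, (m < k)%N -> digit_seq m t = a m] =
  (\prod_(m < k) q (a m))%:E.
Proof.
have [lo loE] := digit_seq_cyl k a.
by apply: unit_measureE loE; apply: prodr_ge0.
Qed.

(** Off the unit interval the sequence is constantly [e0]; inside, the event is a finite union of
    cylinders over the possible first [k] digits. *)
Lemma measurable_digit_seq k a : measurable (digit_seq k @^-1` [set a]).
Proof.
rewrite -[X in measurable X](setIT _) -(setvU `[0, 1[%classic) setIUr.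
apply: measurableU.
  have [->|ae0] := eqVneq a e0.
    rewrite (_ : _ `&` _ = ~` `[0, 1[%classic).
      by apply: measurableC; exact: measurable_itv.
    apply/setIidPr => t /=; rewrite in_itv /= /digit_seq => /negP/negbTE ->.
    by [].
  rewrite (_ : _ `&` _ = set0); first exact: measurable0.
  apply/seteqP; split => t //= [+ /negP]; rewrite in_itv /= /digit_seq => + /negbTE t01.
  by rewrite t01 => ea; rewrite ea eqxx in ae0.
(* The word [b] followed by [a]: at position [k] the [insub] fails and returns [a]. *)
pose ext (b : {ffun 'I_k -> I}) m := if insub m is Some i then b i else a.
rewrite (_ : _ `&` _ = \bigcup_(b in [set: {ffun 'I_k -> I}])
  ([set t | forall m, (m < k.+1)%N -> digit_seq m t = ext b m] `&` `[0, 1[%classic)).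
  apply: fin_bigcup_measurable => // b _.
  by have [lo ->] := digit_seq_cyl k.+1 (ext b); exact: measurable_itv.
apply/seteqP; split => t /=.
  move=> [ta t01]; exists [ffun i : 'I_k => digit_seq i t] => //; split => // m.
  rewrite /ext ltnS leq_eqVlt => /orP[/eqP ->|mk]; first by rewrite insubF ?ltnn.
  by rewrite insubT /= ffunE.
move=> [b _ [h t01]]; split => //; rewrite h // /ext insubF ?ltnn //.
Qed.

End Digits.

(** Positivity of the chosen edge is obtained at every point, so every trajectory uses genuine edges
    and no null set has to be removed. *)
Lemma iid_edges_exists (R : realType) (n : nat) (E : {set 'I_n * 'I_n})
    (p : 'I_n -> 'I_n -> R) :
  (forall e, 0 <= edge_prob E p e) -> \sum_e edge_prob E p e = 1 ->
  exists ev : nat -> measurableTypeR R -> 'I_n * 'I_n,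
    iid_edges (@unit_measure R) ev E p /\ forall k t, 0 < edge_prob E p (ev k t).
Proof.
move=> q_ge0 q_sum1.
have [e0 qe0] : exists e, 0 < edge_prob E p e.
  apply: contrapT => /forallNP h.
  have : \sum_e edge_prob E p e = 0.
    by apply: big1 => e _; apply/eqP; rewrite eq_le q_ge0 andbT leNgt; exact/negP.
  by rewrite q_sum1 => /eqP; rewrite oner_eq0.
exists (digit_seq (edge_prob E p) e0); split; last first.
  by move=> k t; rewrite /digit_seq; case: ifP => // _; exact: digit_gt0.
split=> [k a|k a]; first exact: measurable_digit_seq.
exact: digit_seq_prob.
Qed.

(** * Consensus implies strong connectivity *)

(** As no edge leaves [A], a receiver outside [A] has its sender outside [A] too, so it only
    combines zeros. *)
Lemma gossip_frozen (R : realType) (n : nat) (E : {set 'I_n * 'I_n})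
    (w : 'I_n -> 'I_n -> R) (eps : R) (A : pred 'I_n) (x0 : 'I_n -> R) es :
  (forall j i, (j, i) \in E -> A j -> A i) -> (forall k, es k \in E) ->
  (forall l, ~~ A l -> x0 l = 0) ->
  forall k l, ~~ A l -> (gossip_state w eps x0 es k).1 l = 0 /\
    (gossip_state w eps x0 es k).2 l = 0.
Proof.
move=> closed esE x00; elim=> [|k IH] l Al /=; first by rewrite x00.
move: IH (esE k); case: (gossip_state _ _ _ _ _) => x s /= IH.
case: (es k) => j i /= jiE; have [li|li] := eqVneq l i; last first.
  by rewrite (IH l Al).1; case: ifP => //; rewrite (IH l Al).2.
have Ai : ~~ A i by rewrite -li.
have Aj : ~~ A j by apply: contra Ai; exact: closed jiE.
by rewrite (IH i Ai).1 (IH i Ai).2 (IH j Aj).1 (IH j Aj).2; split; ring.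
Qed.

Lemma consensus_strongly_connected (R : realType) (n : nat) (E : {set 'I_n * 'I_n})
    (p w : 'I_n -> 'I_n -> R) (eps : R) :
  (forall e, 0 <= edge_prob E p e) -> \sum_e edge_prob E p e = 1 ->
  as_average_consensus E p w eps -> strongly_connected E.
Proof.
move=> q_ge0 q_sum1 cons u v; apply: contrapT => /negP uv.
have [ev [iid ev_gt0]] := iid_edges_exists q_ge0 q_sum1.
pose A := connect (fun a b => (a, b) \in E) u.
pose x0 l : R := (A l)%:R.
have evE k t : ev k t \in E.
  by have := ev_gt0 k t; rewrite /edge_prob; case: ifP => //; rewrite ltxx.
(* An almost sure event is nonempty, since otherwise the whole space would be null. *)
have [t /(_ v)[cvgv _]] : exists t : measurableTypeR R, forall l : 'I_n,
    ((fun k => (gossip_state w eps x0 (ev ^~ t) k).1 l) @ \oo -->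
        ((\sum_(l < n) x0 l) / n%:R : R)) /\
    ((fun k => (gossip_state w eps x0 (ev ^~ t) k).2 l) @ \oo --> (0 : R)).
  apply: contrapT => /forallNP none.
  have [N [mN N0 subN]] := cons _ _ _ _ iid x0.
  have NT : N = setT by apply/seteqP; split => // t _; apply: subN; exact: none.
  by move: N0; rewrite NT [LHS]probability_setT => /eqP; rewrite onee_eq0.
have closed j i : (j, i) \in E -> A j -> A i.
  by move=> ji uj; apply: connect_trans uj _; exact: connect1.
have frozen k : (gossip_state w eps x0 (ev ^~ t) k).1 v = 0.
  apply: (proj1 (gossip_frozen w eps closed (fun k => evE k t) _ k uv)).
  by move=> l /negbTE Al; rewrite /x0 Al.
have : (\sum_(l < n) x0 l) / n%:R = 0 :> R.
  move: cvgv; rewrite (_ : (fun k => _) = (fun=> 0)); last exact/funext.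
  move=> cvgv; apply: (cvg_unique (@Rhausdorff R) cvgv); exact: cvg_cst.
apply/eqP; rewrite gt_eqF // divr_gt0 //.
  rewrite (bigD1 u) //= /x0 /A connect0 ltr_pwDl // sumr_ge0 // => i _.
by rewrite ltr0n; apply: leq_ltn_trans (ltn_ord u).
Qed.

Theorem corollary1 (R : realType) (n : nat) (E : {set 'I_n * 'I_n})
  (p w : 'I_n -> 'I_n -> R) :
  (1 < n)%N ->
  (forall i : 'I_n, (i, i) \notin E) ->
  (forall j i : 'I_n, (j, i) \in E -> 0 < p i j < 1) ->
  \sum_(e in E) p e.2 e.1 = 1 ->
  (forall j i : 'I_n, (j, i) \in E -> 0 < w i j < 1) ->
  (strongly_connected E <->
   exists epsb : R, 0 < epsb /\
     forall eps : R, 0 < eps < epsb -> as_average_consensus E p w eps).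
Proof.
move=> _ no_loop p_gt0 p_sum w01; split.
  exact: strongly_connected_consensus.
move=> [epsb [epsb0 cons]].
(* Consensus for a single admissible parameter already forces connectivity. *)
have half : 0 < epsb / 2 < epsb by rewrite divr_gt0 //= ltr_pdivrMr // ltr_pMr // ltr1n.
exact: consensus_strongly_connected (edge_prob_ge0 p_gt0) (edge_prob_sum1 p_sum)
  (cons _ half).
Qed.
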